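(* The full subcategory $\mathrm{Spl}_{\mathcal{RC}}(\mathcal{RC})$ of $\mathcal R$-irreducible rational Casimir modules is a devissage subcategory for the abelian category $\mathcal R$: the inclusion induces an isomorphism $K_0(\mathrm{Spl}_{\mathcal{RC}}(\mathcal{RC}))\cong K_0(\mathcal R)$. Hence $K_0(\mathcal R)$ is isomorphic to the free abelian group on the set of isomorphism classes of $\mathcal R$-irreducible rational Casimir $\mathfrak{sl}(2)$-modules, via the isomorphism $\chi_{JH}\colon K_0(\mathcal R)\to\mathbb{Z}[\widehat{\mathrm{Spl}}_{\mathcal{RC}}(\mathcal{RC})]$ given by $\chi_{JH}([W])=\sum_{i=1}^m[W_i/W_{i-1}]$, where $(W_i)_{i=0}^m$ is a composition series of $W$ in $\mathcal R$.
   Context: $\mathfrak{sl}(2)$ has basis $L_{-1}=f$, $L_0=-\tfrac12 h$, $L_1=-e$ for a Chevalley basis $e,f,h$. An $\mathfrak{sl}(2)$-module $(V,\rho)$ is a $\mathbb{C}[z]$-module via $z\cdot v=\rho(L_0)v$; it is rational if with this structure it is a finite-dimensional $\mathbb{C}(z)$-vector space. $\mathcal R$ is the (essentially small, abelian) full subcategory of rational modules. Casimir: $C_\rho=\rho(L_0)(\rho(L_0)-1)-\rho(L_{-1})\rho(L_1)=\mu\,\mathrm{Id}$ for some $\mu$. $\mathcal R$-irreducible: nonzero with no nonzero proper rational submodule. $\widehat{\mathrm{Spl}}_{\mathcal{RC}}(\mathcal{RC})$ denotes the set of isomorphism classes of $\mathcal R$-irreducible rational Casimir modules. A composition series in $\mathcal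 R$ is a chain of rational submodules with $\mathcal R$-irreducible successive quotients. For an essentially small full subcategory $\mathcal B$ of an abelian category, $K_0(\mathcal B)$ is the free abelian group on isomorphism classes of objects of $\mathcal B$ modulo $[B]=[B']+[B'']$ for every short exact sequence $0\to B'\to B\to B''\to0$ with all terms in $\mathcal B$. *)

(* Defs.v *)
From mathcomp Require Import all_boot all_algebra.
From mathcomp Require Import boolp reals Rstruct complex.
Set Implicit Arguments. Unset Strict Implicit. Unset Printing Implicit Defensive.
Import GRing.Theory.
Local Open Scope ring_scope.

Definition C : fieldType := (Rdefinitions.R)[i].

Record sl2mod := Sl2Mod {
  carrier :> lmodType C;
  act_e : carrier -> carrier;
  act_f : carrier -> carrier;
  act_h : carrier -> carrier;
  act_e_lin : forall (a : C) x y, act_e (a *: x + y) = a *: act_e x + act_e y;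
  act_f_lin : forall (a : C) x y, act_f (a *: x + y) = a *: act_f x + act_f y;
  act_h_lin : forall (a : C) x y, act_h (a *: x + y) = a *: act_h x + act_h y;
  rel_he : forall v, act_h (act_e v) - act_e (act_h v) = 2%:R *: act_e v;
  rel_hf : forall v, act_h (act_f v) - act_f (act_h v) = - (2%:R *: act_f v);
  rel_ef : forall v, act_e (act_f v) - act_f (act_e v) = act_h v
}.

Definition Lm1 (M : sl2mod) (v : M) : M := act_f v.
Definition L0 (M : sl2mod) (v : M) : M := - ((2%:R : C)^-1 *: act_h v).
Definition L1 (M : sl2mod) (v : M) : M := - act_e v.

Definition polyact (M : sl2mod) (p : {poly C}) (v : M) : M :=
  \sum_(i < size p) p`_i *: iter i (@L0 M) v.

(* A subset S of M (assumed a C[z]-submodule) is a finite-dimensional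
   C(z)-vector space for the induced C[z]-action: every nonzero polynomial
   acts bijectively on S (so the action extends uniquely to C(z)), and S is
   spanned over C(z) by finitely many vectors of S. *)
Definition rational_on (M : sl2mod) (S : M -> Prop) : Prop :=
  (forall p : {poly C}, p != 0 ->
     (forall v, S v -> S (polyact p v)) /\
     (forall v w, S v -> S w -> polyact p v = polyact p w -> v = w) /\
     (forall w, S w -> exists2 v, S v & polyact p v = w)) /\
  exists vs : seq M, (forall k, (k < size vs)%N -> S vs`_k) /\
    forall v, S v -> exists2 d : {poly C}, d != 0 &
      exists2 qs : seq {poly C}, size qs = size vs &
        polyact d v = \sum_(k < size vs) polyact qs`_k vs`_k.

Definition rational_mod (M : sl2mod) : Prop := rational_on (fun _ : M => True).

Definition submodule (M : sl2mod) (S : M -> Prop) : Prop :=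
  S 0 /\ (forall (a : C) x y, S x -> S y -> S (a *: x + y)) /\
  (forall x, S x -> S (act_e x) /\ S (act_f x) /\ S (act_h x)).

Definition rational_submodule (M : sl2mod) (S : M -> Prop) : Prop :=
  submodule S /\ rational_on S.

Definition casimir_op (M : sl2mod) (v : M) : M :=
  L0 (L0 v) - L0 v - Lm1 (L1 v).

Definition casimir (M : sl2mod) : Prop :=
  exists mu : C, forall v : M, casimir_op v = mu *: v.

Definition R_irreducible (M : sl2mod) : Prop :=
  rational_mod M /\ (exists v : M, v <> 0) /\
  forall S : M -> Prop, rational_submodule S ->
    (forall v, S v -> v = 0) \/ (forall v, S v).

Definition Spl (M : sl2mod) : Prop := R_irreducible M /\ casimir M.

Definition hom_on (M N : sl2mod) (T : M -> Prop) (g : M -> N) : Prop :=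
  (forall (a : C) x y, T x -> T y -> g (a *: x + y) = a *: g x + g y) /\
  (forall x, T x -> g (act_e x) = act_e (g x) /\ g (act_f x) = act_f (g x)
                     /\ g (act_h x) = act_h (g x)).

Definition hom (M N : sl2mod) (g : M -> N) : Prop := hom_on (fun _ => True) g.

Definition iso (M N : sl2mod) : Prop := exists g : M -> N, hom g /\ bijective g.

Definition ses (A B D : sl2mod) : Prop :=
  exists (i : A -> B) (p : B -> D), hom i /\ hom p /\ injective i /\
    (forall z, exists y, p y = z) /\
    (forall y, p y = 0 <-> exists x, y = i x).

Definition fsum := seq (int * sl2mod).

Fixpoint all_in (P : sl2mod -> Prop) (s : fsum) : Prop :=
  match s with [::] => True | p :: s' => P p.2 /\ all_in P s' end.

Fixpoint coef (s : fsum) (X : sl2mod) : int :=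
  match s with
  | [::] => 0
  | p :: s' => (if `[< iso p.2 X >] then p.1 else 0) + coef s' X
  end.

Definition free_eq (s t : fsum) : Prop := forall X, coef s X = coef t X.

Definition ses_rel (c : int) (ABD : sl2mod * sl2mod * sl2mod) : fsum :=
  [:: (c, ABD.1.2); (- c, ABD.1.1); (- c, ABD.2)].

Fixpoint ses_all (P : sl2mod -> Prop) (rs : seq (int * (sl2mod * sl2mod * sl2mod)))
  : Prop :=
  match rs with
  | [::] => True
  | r :: rs' => let ABD := r.2 in
      (P ABD.1.1 /\ P ABD.1.2 /\ P ABD.2 /\ ses ABD.1.1 ABD.1.2 ABD.2)
      /\ ses_all P rs'
  end.

(* s and t (with all terms in P) define the same element of K_0(P):
   s - t lies in the subgroup of the free abelian group on isomorphism classes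
   of objects of P generated by [B] - [A] - [D] for short exact sequences
   0 -> A -> B -> D -> 0 with all terms in P. *)
Definition K0_eq (P : sl2mod -> Prop) (s t : fsum) : Prop :=
  all_in P s /\ all_in P t /\
  exists rs : seq (int * (sl2mod * sl2mod * sl2mod)),
    ses_all P rs /\ free_eq s (t ++ flatten [seq ses_rel r.1 r.2 | r <- rs]).

(* composition series of W in R together with chosen representatives Xs i of
   the successive quotients W_{i+1}/W_i (given by surjections gs i from W_{i+1}
   onto Xs i with kernel W_i); the quotients are R-irreducible. *)
Definition comp_series (W : sl2mod) (m : nat) (Ws : nat -> W -> Prop)
  (Xs : nat -> sl2mod) (gs : forall i, W -> Xs i) : Prop :=
  (forall v, Ws 0%N v <-> v = 0) /\ (forall v, Ws m v) /\
  (forall i, (i <= m)%N -> rational_submodule (Ws i)) /\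
  (forall i, (i < m)%N ->
     (forall v, Ws i v -> Ws i.+1 v) /\
     hom_on (Ws i.+1) (gs i) /\
     (forall z, exists2 v, Ws i.+1 v & gs i v = z) /\
     (forall v, Ws i.+1 v -> (gs i v = 0 <-> Ws i v)) /\
     R_irreducible (Xs i)).

Definition JHsum (W : sl2mod) (u : fsum) : Prop :=
  exists m Ws Xs gs, @comp_series W m Ws Xs gs /\
    u = [seq (1%:Z, Xs i) | i <- iota 0 m].

Definition fscale (c : int) (u : fsum) : fsum := [seq (c * p.1, p.2) | p <- u].

Inductive chi_rel : fsum -> fsum -> Prop :=
  | chi_nil : chi_rel [::] [::]
  | chi_cons c W u s v : JHsum W u -> chi_rel s v ->
      chi_rel ((c, W) :: s) (fscale c u ++ v).

(* Main.v *)
(* A submodule S of a rational module W is rational iff it is saturated, i.e.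
   p(z) v in S with p != 0 forces v in S: its dimension over C(z) is then bounded
   by that of W. Saturated submodules are stable under intersection, image and
   preimage, and strict inclusions raise the dimension, so the classical
   Jordan-Hoelder argument applies: composition series exist, and their factors
   are unique up to isomorphism and order and additive on short exact sequences.

   The factors are Casimir modules by a Schur-type argument. The Casimir operator
   is C(z)-linear, so some nonzero P in C[z][X] annihilates it. Having finitely many
   eigenvalues in C[z] it forces e and f to be injective, since a vector killed by
   e (or f) would generate infinitely many eigenvalues along its ladder. As f e
   commutes with z and the Casimir while e and f shift z, the polynomial obtained
   from P by shifting z still annihilates the Casimir; taking P of minimal X-degree, then
   with leading coefficient of minimal degree, makes P shift-invariant, hence in
   C[X]. A root of P in C is an eigenvalue of the Casimir, whose eigenspace is a
   nonzero rational submodule.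

   Finally [W] is the sum of its factors in K_0, and the multiplicities are
   invariants of K_0 with values in the free group, so both maps are inverse to
   each other; on irreducible modules K_0-equality is equality in the free group. *)
Require Import Defs.
From HB Require Import structures.
From mathcomp Require Import all_boot all_algebra.
From mathcomp Require Import boolp Rstruct complex ring.
Set Implicit Arguments. Unset Strict Implicit. Unset Printing Implicit Defensive.
Import GRing.Theory.
Local Open Scope ring_scope.

(** * Linear algebra over an integral domain *)

(** Padding [Q] with zero columns gives a square matrix of determinant zero, and [det0P] then yields
    a kernel vector over [D] itself, without passing to fractions. *)
Lemma left_kernel_neq0 (D : idomainType) (m n : nat) (Q : 'M[D]_(m, n)) :
  (n < m)%N -> exists2 r : 'rV[D]_m, r != 0 & r *m Q = 0.
Proof.
move=> ltnm; have e : (n + (m - n) = m)%N by rewrite subnKC // ltnW.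
pose A : 'M[D]_m := castmx (erefl, e) (row_mx Q 0).
have /det0P[r r0 rA] : \det A == 0.
  (* Column [n] is the first of the [m - n > 0] padding columns. *)
  rewrite (expand_det_col _ (Ordinal ltnm)) big1 // => i _.
  rewrite castmxE /= cast_ord_id.
  have h : (0 < m - n)%N by rewrite subn_gt0.
  have -> : cast_ord (esym e) (Ordinal ltnm) = rshift n (Ordinal h).
    by apply: val_inj => /=; rewrite addn0.
  by rewrite row_mxEr mxE mul0r.
exists r => //; apply/rowP => j; rewrite !mxE.
have /rowP/(_ (cast_ord e (lshift _ j))) := rA; rewrite !mxE => {2}<-.
by apply: eq_bigr => i _; rewrite castmxE /= cast_ord_id cast_ordK row_mxEl.
Qed.

Definition lincomb (D : nzRingType) (V : lmodType D) (q : nat -> D) (vs : seq V) : V :=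
  \sum_(k < size vs) q k *: vs`_k.

(** Membership in the span over the fraction field, with denominators cleared: the fraction field is
    never constructed. *)
Definition rat_span (D : idomainType) (V : lmodType D) (vs : seq V) (w : V) : Prop :=
  exists2 d : D, d != 0 & exists q, d *: w = lincomb q vs.

Definition dependent (D : idomainType) (V : lmodType D) (ws : seq V) : Prop :=
  exists2 q : nat -> D, exists2 k, (k < size ws)%N & q k != 0 & lincomb q ws = 0.

Lemma lincomb_cons (D : nzRingType) (V : lmodType D) q (v : V) vs :
  lincomb q (v :: vs) = q 0%N *: v + lincomb (q \o succn) vs.
Proof. by rewrite /lincomb big_ord_recl. Qed.

(** The coefficients expressing multiples of [ws] through [vs] form a matrix with more rows than
    columns. A left kernel vector gives the relation. *)
Lemma steinitz (D : idomainType) (V : lmodType D) (vs ws : seq V) :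
  (forall k, (k < size ws)%N -> rat_span vs ws`_k) -> (size vs < size ws)%N ->
  dependent ws.
Proof.
move=> sp lt.
have /choice[dq dqP] : forall k : 'I_(size ws), exists dq : D * (nat -> D),
    dq.1 != 0 /\ dq.1 *: ws`_k = lincomb dq.2 vs.
  by move=> k; have [d d0 [q qE]] := sp k (ltn_ord k); exists (d, q).
have [r r0 rQ] := left_kernel_neq0 (\matrix_(i < size ws, j < size vs) (dq i).2 j) lt.
(* The kernel vector relates the cleared multiples of [ws], so each entry is multiplied by its
   denominator; outside the range the value is irrelevant. *)
pose c i := if insub i is Some j then r 0 j * (dq j).1 else 0.
exists c.
  have /rV0Pn[j rj] := r0.
  exists j => //; rewrite /c valK mulf_neq0 //; exact: (dqP j).1.
rewrite /lincomb (eq_bigr (fun i => \sum_(j < size vs) (r 0 i * (dq i).2 j) *: vs`_j)).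
  rewrite exchange_big big1 //= => j _; rewrite -scaler_suml.
  have /rowP/(_ j) := rQ; rewrite !mxE => eq0.
  rewrite (eq_bigr (fun i => r 0 i * (\matrix_(i, j) (dq i).2 j) i j)).
    by rewrite eq0 scale0r.
  by move=> i _; rewrite mxE.
move=> i _; rewrite /c valK -scalerA (dqP i).2 scaler_sumr.
by apply: eq_bigr => j _; rewrite scalerA.
Qed.

(** * Saturated submodules and maximal independent families *)

Definition saturated (D : idomainType) (V : lmodType D) (S : V -> Prop) : Prop :=
  [/\ S 0, forall a x y, S x -> S y -> S (a *: x + y)
    & forall d x, d != 0 -> S (d *: x) -> S x].

Definition all_of (V : nmodType) (S : V -> Prop) (us : seq V) : Prop :=
  forall k, (k < size us)%N -> S us`_k.

Lemma all_of_cons (V : nmodType) (S : V -> Prop) v us :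
  S v -> all_of S us -> all_of S (v :: us).
Proof. by move=> Sv Sus [|k] //=; exact: Sus. Qed.

Lemma saturatedN (D : idomainType) (V : lmodType D) (S : V -> Prop) x :
  saturated S -> S x -> S (- x).
Proof. by case=> S0 SD _ Sx; have := SD (-1) x 0 Sx S0; rewrite scaleN1r addr0. Qed.

Lemma saturated_lincomb (D : idomainType) (V : lmodType D) (S : V -> Prop) q us :
  saturated S -> all_of S us -> S (lincomb q us).
Proof.
case=> S0 SD _ Sus; rewrite /lincomb.
have Scl x y : S x -> S y -> S (x + y) by move=> Sx /(SD 1 x _ Sx); rewrite scale1r.
apply: big_ind => // k _; rewrite -[_ *: _]addr0; apply: SD => //; exact: Sus.
Qed.

(** A relation with nonzero coefficient at [v] puts a multiple of [v] in [S], and saturation puts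
    [v] there too. This is how a strict inclusion raises the dimension. *)
Lemma independent_cons (D : idomainType) (V : lmodType D) (S : V -> Prop) v us :
  saturated S -> all_of S us -> ~ S v -> ~ dependent us -> ~ dependent (v :: us).
Proof.
move=> satS Sus nSv ind [q [k kl qk]]; rewrite lincomb_cons => eq0.
have [q0|q0] := eqVneq (q 0%N) 0.
  apply: ind; exists (q \o succn); last by rewrite q0 scale0r add0r in eq0.
  by case: k kl qk => [|k] kl qk; [rewrite q0 eqxx in qk | exists k].
apply: nSv; case: (satS) => _ _; apply; first exact: q0.
move/eqP: eq0; rewrite addr_eq0 => /eqP->.
exact: saturatedN (saturated_lincomb _ satS Sus).
Qed.

Lemma max_size_seq (T : Type) (Q : seq T -> Prop) n :
  Q [::] -> (forall us, Q us -> (size us <= n)%N) ->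
  exists2 us, Q us & forall us', Q us' -> (size us' <= size us)%N.
Proof.
move=> Q0 bound; pose P m := `[< exists2 us, Q us & size us = m >].
have exP : exists m, P m by exists 0%N; apply/asboolP; exists [::].
have boundP m : P m -> (m <= n)%N by case/asboolP=> us Qus <-; exact: bound.
have [m /asboolP[us Qus <-] maxm] := ex_maxnP exP boundP.
by exists us => // us' Qus'; apply: maxm; apply/asboolP; exists us'.
Qed.

(** An independent family in [S] of maximal size exists because Steinitz bounds its size by
    [size vs]; by maximality it spans [S]. *)
Lemma saturated_basis (D : idomainType) (V : lmodType D) (vs : seq V) (S : V -> Prop) :
  (forall v, rat_span vs v) ->
  exists2 us, all_of S us & forall v, S v -> rat_span us v.
Proof.
move=> span.
have [||us [Sus indus] maxus] :=
  @max_size_seq V (fun us => all_of S us /\ ~ dependent us) (size vs).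
- by split=> // -[q [k]].
- move=> us [_ ind]; rewrite leqNgt; apply/negP => lt; apply: ind.
  exact: steinitz lt.
exists us => // v Sv.
have [[q [k kl qk]]|ind] := pselect (dependent (v :: us)); last first.
  by have := maxus (v :: us) (conj (all_of_cons Sv Sus) ind); rewrite /= ltnn.
(* If the coefficient of [v] vanishes, the relation contradicts the independence of [us]; otherwise
   it serves as the denominator. *)
rewrite lincomb_cons => eq0; have [q0|q0] := eqVneq (q 0%N) 0.
  case: indus; exists (q \o succn); last by rewrite q0 scale0r add0r in eq0.
  by case: k kl qk => [|k] kl qk; [rewrite q0 eqxx in qk | exists k].
exists (q 0%N) => //; exists (fun i => - q i.+1); apply/eqP.
rewrite -subr_eq0 -[eqbRHS]eq0 {2}/lincomb; apply/eqP; congr (_ + _).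
by rewrite -sumrN; apply: eq_bigr => i _ /=; rewrite scaleNr opprK.
Qed.

(** * Polynomials in an operator, and the C[z]-module structure *)

(** The same formula as [polyact] for an arbitrary operator. [polyact] is convertible to the case of
    [L0] over [C]; the other use is the Casimir operator over [{poly C}]. *)
Definition poly_op (K : comNzRingType) (V : lmodType K) (phi : V -> V)
  (p : {poly K}) (v : V) : V := \sum_(i < size p) p`_i *: iter i phi v.

Lemma poly_opE (K : comNzRingType) (V : lmodType K) (phi : V -> V) n (p : {poly K}) v :
  (size p <= n)%N -> poly_op phi p v = \sum_(i < n) p`_i *: iter i phi v.
Proof.
move=> le; rewrite /poly_op (big_ord_widen n (fun i => p`_i *: iter i phi v)) //.
rewrite [RHS](bigID (fun i : 'I_n => (i < size p)%N)) /= [X in _ + X]big1 ?addr0 //.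
by move=> i; rewrite -leqNgt => h; rewrite nth_default // scale0r.
Qed.

Lemma poly_opD (K : comNzRingType) (V : lmodType K) (phi : V -> V) p q v :
  poly_op phi (p + q) v = poly_op phi p v + poly_op phi q v.
Proof.
pose n := maxn (size p) (size q).
rewrite !(@poly_opE _ _ _ n) ?leq_maxl ?leq_maxr // ?size_polyD //.
by rewrite -big_split; apply: eq_bigr => i _; rewrite coefD scalerDl.
Qed.

Lemma poly_opZ (K : comNzRingType) (V : lmodType K) (phi : V -> V) c p v :
  poly_op phi (c *: p) v = c *: poly_op phi p v.
Proof.
rewrite !(@poly_opE _ _ _ (size p)) ?size_scale_leq // scaler_sumr.
by apply: eq_bigr => i _; rewrite coefZ scalerA.
Qed.

Lemma poly_opC (K : comNzRingType) (V : lmodType K) (phi : V -> V) c v :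
  poly_op phi c%:P v = c *: v.
Proof. by rewrite (@poly_opE _ _ _ 1) ?size_polyC_leq1 // big_ord1 coefC. Qed.

Lemma poly_op0 (K : comNzRingType) (V : lmodType K) (phi : V -> V) v :
  poly_op phi 0 v = 0.
Proof. by rewrite -polyC0 poly_opC scale0r. Qed.

Lemma poly_opMX (K : comNzRingType) (V : lmodType K) (phi : V -> V) p v :
  poly_op phi (p * 'X) v = poly_op phi p (phi v).
Proof.
rewrite (@poly_opE _ _ _ (size p).+1); last first.
  by apply: leq_trans (size_polyMleq _ _) _; rewrite size_polyX addn2.
rewrite big_ord_recl coefMX eqxx scale0r add0r.
by apply: eq_bigr => i _; rewrite coefMX /= -iterSr.
Qed.

Lemma poly_opX (K : comNzRingType) (V : lmodType K) (phi : V -> V) v :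
  poly_op phi 'X v = phi v.
Proof. by rewrite -['X]mul1r poly_opMX -polyC1 poly_opC scale1r. Qed.

Lemma linear_iter (K : comNzRingType) (V : lmodType K) (phi : V -> V) i :
  linear phi -> linear (iter i phi).
Proof. by move=> lin a u v; elim: i => //= i ->; rewrite lin. Qed.

Lemma poly_op_linear (K : comNzRingType) (V : lmodType K) (phi : V -> V) p :
  linear phi -> linear (poly_op phi p).
Proof.
move=> lin a u v; rewrite /poly_op scaler_sumr -big_split.
apply: eq_bigr => i _; rewrite (linear_iter i lin) scalerDr !scalerA.
by rewrite [a * _]mulrC.
Qed.

Lemma linear_eq0 (K : pzRingType) (U V : lmodType K) (g : U -> V) : linear g -> g 0 = 0.
Proof. by move=> lin; have := lin (-1) 0 0; rewrite !scaleN1r oppr0 addr0 addNr. Qed.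

Lemma linear_eqD (K : pzRingType) (U V : lmodType K) (g : U -> V) :
  linear g -> {morph g : x y / x + y}.
Proof. by move=> lin x y; have := lin 1 x y; rewrite !scale1r. Qed.

Lemma linear_eqZ (K : pzRingType) (U V : lmodType K) (g : U -> V) a :
  linear g -> {morph g : x / a *: x}.
Proof.
by move=> lin x; have := lin a x 0; rewrite (linear_eq0 lin) !addr0.
Qed.

Lemma linear_eqN (K : pzRingType) (U V : lmodType K) (g : U -> V) :
  linear g -> {morph g : x / - x}.
Proof. by move=> lin x; rewrite -scaleN1r linear_eqZ // scaleN1r. Qed.

Lemma linear_eqB (K : pzRingType) (U V : lmodType K) (g : U -> V) :
  linear g -> {morph g : x y / x - y}.
Proof. by move=> lin x y; rewrite linear_eqD // linear_eqN. Qed.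

Lemma poly_opM (K : comNzRingType) (V : lmodType K) (phi : V -> V) p q v :
  linear phi -> poly_op phi (p * q) v = poly_op phi p (poly_op phi q v).
Proof.
move=> lin; elim/poly_ind: q v => [|q c IH] v.
  by rewrite mulr0 !poly_op0 (linear_eq0 (poly_op_linear _ lin)).
rewrite mulrDr mulrA [p * c%:P]mulrC mul_polyC !poly_opD !poly_opMX IH poly_opZ poly_opC.
by rewrite (linear_eqD (poly_op_linear _ lin)) (linear_eqZ _ (poly_op_linear _ lin)).
Qed.

Lemma poly_op_comm (K : comNzRingType) (V : lmodType K) (phi g : V -> V) p v :
  linear g -> (forall v, g (phi v) = phi (g v)) ->
  g (poly_op phi p v) = poly_op phi p (g v).
Proof.
move=> lin com; elim/poly_ind: p v => [|p c IH] v; first by rewrite !poly_op0 linear_eq0.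
by rewrite !poly_opD !poly_opMX !poly_opC linear_eqD // linear_eqZ // IH com.
Qed.

Lemma L0_linear (W : sl2mod) : linear (@L0 W).
Proof.
move=> a x y; rewrite /L0 act_h_lin scalerDr opprD scalerN !scalerA.
by rewrite [_ * a]mulrC.
Qed.

(* An alias of the carrier: W itself keeps its C-linear structure, while
   [zmodule_of W] is the C[z]-module on which z acts by L0. *)
Definition zmodule_of (W : sl2mod) : Type := W.
HB.instance Definition _ (W : sl2mod) := GRing.Zmodule.on (zmodule_of W).

Lemma polyactA (W : sl2mod) p q (v : zmodule_of W) :
  polyact p (polyact q v : W) = polyact (p * q) (v : W).
Proof. by rewrite [RHS](poly_opM _ _ _ (@L0_linear W)). Qed.

Lemma polyact1 (W : sl2mod) : left_id 1 (@polyact W).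
Proof. by move=> v; rewrite [LHS](poly_opC _ 1) scale1r. Qed.

Lemma polyactDr (W : sl2mod) : right_distributive (@polyact W) +%R.
Proof.
by move=> p u v; exact: (linear_eqD (poly_op_linear p (@L0_linear W))).
Qed.

Lemma polyactDl (W : sl2mod) (v : W) : {morph (@polyact W)^~ v : p q / p + q}.
Proof. by move=> p q; exact: (@poly_opD _ _ (@L0 W)). Qed.

HB.instance Definition _ (W : sl2mod) :=
  GRing.Zmodule_isLmodule.Build {poly C} (zmodule_of W)
    (@polyactA W) (@polyact1 W) (@polyactDr W) (@polyactDl W).

Lemma polyactE (W : sl2mod) p (v : W) : polyact p v = p *: (v : zmodule_of W).
Proof. by []. Qed.

Lemma polyC_scale (W : sl2mod) c (v : W) : c *: v = c%:P *: (v : zmodule_of W).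
Proof. by rewrite -polyactE [RHS](poly_opC (@L0 W)). Qed.

Lemma L0_scale (W : sl2mod) (v : W) : L0 v = 'X *: (v : zmodule_of W).
Proof. by rewrite -polyactE [RHS](poly_opX (@L0 W)). Qed.

Lemma linear_act_e (W : sl2mod) : linear (@act_e W).
Proof. by move=> a x y; rewrite act_e_lin. Qed.
Lemma linear_act_f (W : sl2mod) : linear (@act_f W).
Proof. by move=> a x y; rewrite act_f_lin. Qed.
Lemma linear_act_h (W : sl2mod) : linear (@act_h W).
Proof. by move=> a x y; rewrite act_h_lin. Qed.

Lemma C_natr_inj : injective (fun n : nat => n%:R : C).
Proof.
move=> m n /eqP; have /= -> := @Num.Theory.eqr_nat (Rdefinitions.R)[i] m n.
by move/eqP.
Qed.

Lemma C_natr_neq0 (n : nat) : (n.+1%:R : C) != 0.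
Proof. by apply/eqP => /(@C_natr_inj n.+1 0). Qed.

Lemma act_hE (W : sl2mod) (v : W) : act_h v = - (2%:R *: L0 v).
Proof. by rewrite /L0 scalerN opprK scalerA divff ?(C_natr_neq0 1) // scale1r. Qed.

(** Dividing [[h, e] = 2 e] by [-2]: [e] lowers the eigenvalues of [L0] by one. Dually, [f] raises
    them. *)
Lemma L0_e (W : sl2mod) (v : W) : L0 (act_e v) = act_e (L0 v) - act_e v.
Proof.
rewrite /L0 (linear_eqN (@linear_act_e W)) (linear_eqZ _ (@linear_act_e W)).
have /eqP := rel_he v; rewrite subr_eq => /eqP->.
by rewrite scalerDr scalerA mulVf ?(C_natr_neq0 1) // scale1r opprD addrC.
Qed.

Lemma L0_f (W : sl2mod) (v : W) : L0 (act_f v) = act_f (L0 v) + act_f v.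
Proof.
rewrite /L0 (linear_eqN (@linear_act_f W)) (linear_eqZ _ (@linear_act_f W)).
have /eqP := rel_hf v; rewrite subr_eq => /eqP->.
by rewrite scalerDr scalerN scalerA mulVf ?(C_natr_neq0 1) // scale1r opprD opprK addrC.
Qed.

(** * Commutation of e and f with polynomials in z *)

Definition shift (c : C) (p : {poly C}) : {poly C} := p \Po ('X + c%:P).

Lemma polyact_MXaddC (W : sl2mod) p c (v : W) :
  polyact (p * 'X + c%:P) v = polyact p (L0 v) + c *: v.
Proof. by rewrite [LHS]poly_opD poly_opMX poly_opC. Qed.

(** From [g z = (z + c) g] one gets [g p(z) = p(z + c) g] by induction on [p]. *)
Lemma polyact_shift (W : sl2mod) (g : W -> W) (c : C) p (v : W) : linear g ->
  (forall v, g (L0 v) = L0 (g v) + c *: g v) ->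
  g (polyact p v) = polyact (shift c p) (g v).
Proof.
move=> lin com; elim/poly_ind: p v => [|p a IH] v.
  by rewrite /shift comp_poly0 !polyactE !scale0r linear_eq0.
rewrite polyact_MXaddC (linear_eqD lin) IH com (linear_eqZ a lin).
rewrite /shift comp_polyD comp_polyM comp_polyX comp_polyC polyactDl -polyactA.
rewrite [polyact ('X + _) _]polyactDl; congr (polyact _ (_ + _) + _).
- by rewrite polyactE -L0_scale.
- by rewrite polyactE -polyC_scale.
- by rewrite polyactE -polyC_scale.
Qed.

Lemma polyact_e (W : sl2mod) p (v : W) :
  act_e (polyact p v) = polyact (shift 1 p) (act_e v).
Proof.
apply: polyact_shift (@linear_act_e W) _ => w.
by rewrite L0_e scale1r subrK.
Qed.

Lemma polyact_f (W : sl2mod) p (v : W) :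
  act_f (polyact p v) = polyact (shift (-1) p) (act_f v).
Proof.
apply: polyact_shift (@linear_act_f W) _ => w.
by rewrite L0_f scaleN1r addrK.
Qed.

(** * Rational submodules and homomorphisms *)

(** Working form of [rational_submodule], equivalent to it inside a rational module but free of
    divisibility and finiteness conditions. *)
Definition sat_submodule (W : sl2mod) (S : W -> Prop) : Prop :=
  submodule S /\ forall p v, p != 0 -> S (polyact p v) -> S v.

Lemma submodule_setT (W : sl2mod) : submodule (fun _ : W => True).
Proof. by []. Qed.

Lemma submodule_lin (W : sl2mod) (S : W -> Prop) a x y :
  submodule S -> S x -> S y -> S (a *: x + y).
Proof. by case=> _ [+ _]; apply. Qed.

Lemma submodule_scale (W : sl2mod) (S : W -> Prop) a x :
  submodule S -> S x -> S (a *: x).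
Proof. by move=> sS Sx; rewrite -[_ *: _]addr0; apply: submodule_lin => //; case: sS. Qed.

Lemma submodule_sub (W : sl2mod) (S : W -> Prop) x y :
  submodule S -> S x -> S y -> S (x - y).
Proof. by move=> sS Sx Sy; rewrite addrC -scaleN1r; exact: submodule_lin. Qed.

Lemma submodule_add (W : sl2mod) (S : W -> Prop) x y :
  submodule S -> S x -> S y -> S (x + y).
Proof. by move=> sS Sx Sy; rewrite -[x]scale1r; exact: submodule_lin. Qed.

Lemma submodule_L0 (W : sl2mod) (S : W -> Prop) x : submodule S -> S x -> S (L0 x).
Proof.
move=> sS Sx; rewrite /L0 -scaleNr; apply: submodule_scale => //.
by case: sS => _ [_ /(_ x Sx) [_ []]].
Qed.

Lemma submodule_polyact (W : sl2mod) (S : W -> Prop) p x :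
  submodule S -> S x -> S (polyact p x).
Proof.
move=> sS Sx; elim/poly_ind: p x Sx => [|p c IH] x Sx.
  by rewrite polyactE scale0r; case: sS.
rewrite polyact_MXaddC addrC; apply: submodule_lin => //.
by apply: IH; exact: submodule_L0.
Qed.

Lemma sat_submodule_saturated (W : sl2mod) (S : W -> Prop) :
  sat_submodule S -> @saturated {poly C} (zmodule_of W) S.
Proof.
case=> sS satS; split; first by case: sS.
  by move=> p x y Sx Sy; apply: submodule_add => //; exact: submodule_polyact.
by move=> d x d0; exact: satS.
Qed.

Definition finitely_spanned (W : sl2mod) : Prop :=
  exists vs : seq (zmodule_of W), forall v, @rat_span {poly C} (zmodule_of W) vs v.

Lemma rat_span_polyact (W : sl2mod) (vs : seq W) (v : W) :
  @rat_span {poly C} (zmodule_of W) vs v <->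
  exists2 d : {poly C}, d != 0 &
      exists2 qs : seq {poly C}, size qs = size vs &
        polyact d v = \sum_(k < size vs) polyact qs`_k vs`_k.
Proof.
split=> -[d d0]; last by case=> qs _ h; exists d => //; exists (fun i => qs`_i).
case=> q qE; exists d => //; exists (mkseq q (size vs)); first by rewrite size_mkseq.
rewrite [LHS]qE; apply: eq_bigr => i _; rewrite nth_mkseq //.
Qed.

Lemma rational_modP (W : sl2mod) : rational_mod W <->
  [/\ forall p (v : W), p != 0 -> polyact p v = 0 -> v = 0,
      forall p (w : W), p != 0 -> exists v, polyact p v = w
    & finitely_spanned W].
Proof.
split=> [[div [vs [_ span]]]|[tf div [vs span]]].
  split; last by exists vs => v; apply/rat_span_polyact; exact: span.
    move=> p v p0 pv; have [_ [inj _]] := div p p0.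
    by apply: inj => //; rewrite pv [RHS]polyactE scaler0.
  by move=> p w p0; have [_ [_ /(_ w I)[v _ vE]]] := div p p0; exists v.
split; last by exists vs; split=> // v _; exact/rat_span_polyact.
move=> p p0; split=> //; split.
  move=> v w _ _ eqvw; apply/eqP; rewrite -subr_eq0; apply/eqP/(tf p) => //.
  by rewrite polyactE scalerBr -!polyactE eqvw subrr.
by move=> w _; have [v vE] := div p w p0; exists v.
Qed.

(** If [p v] lies in a rational [S], its quotient by [p] inside [S] equals [v], as [W] is
    torsion-free. Conversely, quotients taken in [W] stay in a saturated [S], and [saturated_basis]
    provides the finite spanning family. *)
Lemma rational_submoduleP (W : sl2mod) (S : W -> Prop) : rational_mod W ->
  rational_submodule S <-> sat_submodule S.
Proof.
move=> /rational_modP[tf div [vs span]]; split=> [[sS [divS _]]|satS].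
  split=> // p v p0 Spv; have [_ [_ /(_ _ Spv)[u Su uE]]] := divS p p0.
  suff <- : u = v by [].
  apply/eqP; rewrite -subr_eq0; apply/eqP/(tf p) => //.
  by rewrite polyactE scalerBr -!polyactE uE subrr.
have [sS cl] := satS; split=> //; split.
  move=> p p0; split; first by move=> v; exact: submodule_polyact.
  split=> [v w _ _ eqvw|w Sw].
    apply/eqP; rewrite -subr_eq0; apply/eqP/(tf p) => //.
    by rewrite polyactE scalerBr -!polyactE eqvw subrr.
  by have [v vE] := div p w p0; exists v => //; apply: (cl p) => //; rewrite vE.
have [us Sus spanS] := @saturated_basis {poly C} (zmodule_of W) vs S span.
by exists us; split=> // v Sv; apply/rat_span_polyact; exact: spanS.
Qed.

(** * Maps that are homomorphisms on a submodule *)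

Section HomOn.
Variables (M N : sl2mod) (T : M -> Prop) (g : M -> N).
Hypotheses (sT : submodule T) (hg : hom_on T g).

Lemma hom_lin a x y : T x -> T y -> g (a *: x + y) = a *: g x + g y.
Proof. by case: hg => + _; apply. Qed.

Lemma hom0 : g 0 = 0.
Proof.
have T0 : T 0 by case: sT.
by have := hom_lin (-1) T0 T0; rewrite !scaleN1r oppr0 addr0 addNr.
Qed.

Lemma homZ a x : T x -> g (a *: x) = a *: g x.
Proof.
by move=> Tx; have := hom_lin a Tx (proj1 sT); rewrite hom0 !addr0.
Qed.

Lemma homD x y : T x -> T y -> g (x + y) = g x + g y.
Proof. by move=> Tx Ty; have := hom_lin 1 Tx Ty; rewrite !scale1r. Qed.

Lemma homB x y : T x -> T y -> g (x - y) = g x - g y.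
Proof.
by move=> Tx Ty; have := hom_lin (-1) Ty Tx; rewrite !scaleN1r ![- _ + _]addrC.
Qed.

Lemma hom_L0 x : T x -> g (L0 x) = L0 (g x).
Proof.
move=> Tx; rewrite /L0 -!scaleNr homZ; first by case: hg => _ /(_ x Tx)[_ [_ ->]].
by case: sT => _ [_ /(_ x Tx)[_ []]].
Qed.

Lemma hom_polyact p x : T x -> g (polyact p x) = polyact p (g x).
Proof.
move=> Tx; elim/poly_ind: p x Tx => [|p c IH] x Tx.
  by rewrite !polyactE !scale0r hom0.
rewrite !polyact_MXaddC homD ?homZ ?IH ?hom_L0 //; try exact: submodule_L0.
  by apply: submodule_polyact => //; exact: submodule_L0.
exact: submodule_scale.
Qed.

Lemma hom_sum n (F : nat -> M) : (forall i, (i < n)%N -> T (F i)) ->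
  T (\sum_(i < n) F i) /\ g (\sum_(i < n) F i) = \sum_(i < n) g (F i).
Proof.
elim: n => [|n IH] TF; first by rewrite !big_ord0 hom0; split=> //; case: sT.
rewrite !big_ord_recr /=; have [|TS <-] := IH; first by move=> i /ltnW; exact: TF.
have Tn : T (F n) by exact: TF.
by rewrite homD //; split=> //; exact: submodule_add.
Qed.

Lemma submodule_preim S : submodule S -> submodule (fun x => T x /\ S (g x)).
Proof.
move=> sS; have [T0 [Tl Ta]] := sT; have [S0 [Sl Sa]] := sS.
split; first by rewrite hom0.
split=> [a x y [Tx Sx] [Ty Sy]|x [Tx Sx]].
  by split; [exact: Tl | rewrite hom_lin //; exact: Sl].
have [Te [Tf Th]] := Ta _ Tx; have [Se [Sf Sh]] := Sa _ Sx.
by case: hg => _ /(_ x Tx)[-> [-> ->]].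
Qed.

Lemma submodule_im S : submodule S -> (forall x, S x -> T x) ->
  submodule (fun y => exists2 x, S x & g x = y).
Proof.
move=> [S0 [Sl Sa]] ST; split; first by exists 0; rewrite ?hom0.
split=> [a x y [u Su <-] [v Sv <-]|x [u Su <-]].
  by exists (a *: u + v); [exact: Sl | rewrite hom_lin //; exact: ST].
have [Se [Sf Sh]] := Sa _ Su; case: hg => _ /(_ u (ST _ Su))[ge [gf gh]].
by split; [exists (act_e u)|split; [exists (act_f u)|exists (act_h u)]].
Qed.

Lemma sat_preim S : sat_submodule T -> sat_submodule S ->
  sat_submodule (fun x => T x /\ S (g x)).
Proof.
move=> [_ cT] [sS cS]; split; first exact: submodule_preim.
move=> p v p0 [Tpv]; have Tv : T v by exact: cT Tpv.
by rewrite hom_polyact // => h; split=> //; exact: (cS p).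
Qed.

(** If [p w = g x], divide [x] by [p] inside [S]; the image of the result equals [w] because [N] is
    torsion-free. *)
Lemma sat_im S : rational_mod M -> rational_mod N -> sat_submodule S ->
  (forall x, S x -> T x) -> sat_submodule (fun y => exists2 x, S x & g x = y).
Proof.
move=> /rational_modP[tfM divM _] /rational_modP[tfN _ _] [sS cS] ST.
split; first exact: submodule_im.
move=> p w p0 [x Sx gx]; have [v vE] := divM p x p0.
have Sv : S v by apply: (cS p) => //; rewrite vE.
exists v => //; apply/eqP; rewrite -subr_eq0; apply/eqP/(tfN p) => //.
rewrite polyactE scalerBr -!polyactE -gx -vE hom_polyact ?subrr //; exact: ST.
Qed.

(** The quotient is torsion-free because the kernel [S] is saturated, divisible because [T] is, and
    spanned by the image of a family spanning [T]. *)
Lemma quotient_rational S : rational_mod M -> sat_submodule T -> sat_submodule S ->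
  (forall z, exists2 v, T v & g v = z) ->
  (forall v, T v -> (g v = 0 <-> S v)) -> rational_mod N.
Proof.
move=> rM satT [_ cS] surj ker; have [_ cT] := satT; apply/rational_modP; split.
- move=> p z p0; have [v Tv <-] := surj z; rewrite -hom_polyact // => h.
  apply/(ker _ Tv)/(cS p) => //; apply/ker => //; exact: submodule_polyact.
- move=> p z p0; have [v Tv <-] := surj z.
  have /rational_modP[_ /(_ p v p0)[u uE] _] := rM.
  have Tu : T u by apply: (cT p) => //; rewrite uE.
  by exists (g u); rewrite -hom_polyact // uE.
have /rational_modP[_ _ [vs span]] := rM.
have [us Tus spanT] := @saturated_basis {poly C} (zmodule_of M) vs T span.
exists (map g us : seq (zmodule_of N)) => z; have [v Tv <-] := surj z.
have [d d0 [q qE]] := spanT v Tv; exists d => //; exists q.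
have -> : d *: (g v : zmodule_of N) = g (d *: (v : zmodule_of M)).
  by rewrite -!polyactE hom_polyact.
rewrite qE /lincomb size_map.
have [|_ ->] := @hom_sum (size us) (fun k => q k *: (us`_k : zmodule_of M)).
  by move=> i /Tus; exact: submodule_polyact.
apply: eq_bigr => i _; rewrite (nth_map 0) // -!polyactE hom_polyact //; exact: Tus.
Qed.

End HomOn.

Lemma hom_on_sub (M N : sl2mod) (T S : M -> Prop) (g : M -> N) :
  hom_on T g -> (forall x, S x -> T x) -> hom_on S g.
Proof.
by move=> [gl ga] ST; split=> [a x y /ST Tx /ST|x /ST]; [exact: gl | exact: ga].
Qed.

(** Maps are obtained from additive relations by choice. Single-valuedness need only be checked at
    [0], since two values at one point differ by a value at [0]. *)
Lemma hom_of_graph (M N : sl2mod) (T : M -> Prop) (G : M -> N -> Prop) :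
  submodule T -> (forall x, T x -> exists y, G x y) ->
  (forall y, G 0 y -> y = 0) ->
  (forall (a : C) x x' y y', G x y -> G x' y' -> G (a *: x + x') (a *: y + y')) ->
  (forall x y, G x y -> [/\ G (act_e x) (act_e y), G (act_f x) (act_f y)
     & G (act_h x) (act_h y)]) ->
  exists2 g : M -> N, hom_on T g & forall x, T x -> G x (g x).
Proof.
move=> sT tot G0 Gl Ga.
have fct x y y' : G x y -> G x y' -> y = y'.
  move=> Gy Gy'; have := Gl (-1) _ _ _ _ Gy' Gy; rewrite !scaleN1r addNr.
  by move=> /G0/eqP; rewrite addrC subr_eq0 => /eqP.
have /choice[g gP] : forall x, exists y, T x -> G x y.
  move=> x; have [/tot[y]|nTx] := pselect (T x); first by exists y.
  by exists 0.
have [T0 [Tl Ta]] := sT.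
exists g => //; split=> [a x y Tx Ty|x Tx].
  apply: (fct (a *: x + y)); first exact/gP/Tl.
  by apply: Gl; exact: gP.
have [Te [Tf Th]] := Ta _ Tx; have [Ge Gf Gh] := Ga _ _ (gP _ Tx).
by split; [|split]; (apply: fct; first exact: gP) => //.
Qed.

Lemma iso_of_graph (M N : sl2mod) (G : M -> N -> Prop) :
  (forall x, exists y, G x y) -> (forall y, exists x, G x y) ->
  (forall y, G 0 y -> y = 0) -> (forall x, G x 0 -> x = 0) ->
  (forall (a : C) x x' y y', G x y -> G x' y' -> G (a *: x + x') (a *: y + y')) ->
  (forall x y, G x y -> [/\ G (act_e x) (act_e y), G (act_f x) (act_f y)
     & G (act_h x) (act_h y)]) ->
  iso M N.
Proof.
move=> tot surj G0 G0' Gl Ga.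
have [g hg Gg] := hom_of_graph (submodule_setT M) (fun x _ => tot x) G0 Gl Ga.
have [||g' hg' Gg'] :=
  @hom_of_graph N M _ (fun y x => G x y) (submodule_setT N) (fun y _ => surj y) G0'.
- by move=> a x x' y y'; exact: Gl.
- by move=> x y /Ga.
have inj x x' y : G x y -> G x' y -> x = x'.
  move=> Gy Gy'; have := Gl (-1) _ _ _ _ Gy' Gy; rewrite !scaleN1r addNr.
  by move=> /G0'/eqP; rewrite addrC subr_eq0 => /eqP.
have fct x y y' : G x y -> G x y' -> y = y'.
  move=> Gy Gy'; have := Gl (-1) _ _ _ _ Gy' Gy; rewrite !scaleN1r addNr.
  by move=> /G0/eqP; rewrite addrC subr_eq0 => /eqP.
exists g; split=> //; exists g' => x.
  by apply: inj (Gg x I); exact: Gg'.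
by apply: fct (Gg' x I); exact: Gg.
Qed.

Lemma iso_refl (M : sl2mod) : iso M M.
Proof. by exists id; split=> //; exists id. Qed.

Lemma iso_sym (M N : sl2mod) : iso M N -> iso N M.
Proof.
case=> g [[gl ga] [g' gK g'K]]; exists g'; split; last by exists g.
split=> [a x y _ _|x _].
  by apply: (can_inj gK); rewrite gl // !g'K.
by have [ge [gf gh]] := ga (g' x) I;
  split; [|split]; apply: (can_inj gK); rewrite ?ge ?gf ?gh !g'K.
Qed.

Lemma iso_trans (M N P : sl2mod) : iso M N -> iso N P -> iso M P.
Proof.
case=> g [[gl ga] gb] [k [[kl ka] kb]]; exists (k \o g); split; last exact: bij_comp.
split=> [a x y _ _|x _] /=; first by rewrite gl // kl.
have [-> [-> ->]] := ga x I; exact: ka.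
Qed.

(** The graph consists of the pairs of [g v] and [g' v] for [v] in [T]; equality of the kernels
    makes it bijective. *)
Lemma quotients_iso (M N N' : sl2mod) (T : M -> Prop) (g : M -> N) (g' : M -> N') :
  submodule T -> hom_on T g -> hom_on T g' ->
  (forall z, exists2 v, T v & g v = z) -> (forall z, exists2 v, T v & g' v = z) ->
  (forall v, T v -> (g v = 0 <-> g' v = 0)) -> iso N N'.
Proof.
move=> sT hg hg' surj surj' ker.
apply: (@iso_of_graph _ _ (fun x y => exists2 v, T v & g v = x /\ g' v = y)).
- by move=> x; have [v Tv vE] := surj x; exists (g' v), v.
- by move=> y; have [v Tv vE] := surj' y; exists (g v), v.
- by move=> y [v Tv [/(ker _ Tv) -> <-]].
- by move=> y [v Tv [<- /(ker _ Tv) ->]].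
- move=> a x x' y y' [v Tv [<- <-]] [w Tw [<- <-]].
  by exists (a *: v + w); [exact: submodule_lin | rewrite !(hom_lin _ _ Tv Tw)].
move=> x y [v Tv [<- <-]]; have [_ [_ /(_ v Tv)[Te [Tf Th]]]] := sT.
have [_ /(_ v Tv)[<- [<- <-]]] := hg; have [_ /(_ v Tv)[<- [<- <-]]] := hg'.
by split; [exists (act_e v)|exists (act_f v)|exists (act_h v)].
Qed.

(** * Subquotients *)

Record subquotient_data (W : sl2mod) := SubquotientData {
  subquo_top : W -> Prop;
  subquo_bot : W -> Prop;
  subquo_topP : submodule subquo_top;
  subquo_botP : submodule subquo_bot;
  subquo_sub : forall x, subquo_bot x -> subquo_top x
}.

Section Subquotient.
Variables (W : sl2mod) (d : subquotient_data W).
Notation T := (@subquo_top W d).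
Notation B := (@subquo_bot W d).

(* A canonical representative of the coset x + B: [choose] depends only on the
   predicate, so equal cosets get equal representatives. *)
Definition coset_repr (x : W) : W := choose (fun y => `[< B (x - y) >]) x.

Lemma coset_reprP x : B (x - coset_repr x).
Proof.
apply/asboolP; apply: (@chooseP _ (fun y => `[< B (x - y) >])).
by apply/asboolP; rewrite subrr; case: (subquo_botP d).
Qed.

Lemma coset_repr_eq x y : B (x - y) -> coset_repr x = coset_repr y.
Proof.
move=> Bxy; rewrite /coset_repr.
have eqP z : `[< B (x - z) >] = `[< B (y - z) >].
  apply/asboolP/asboolP => h.
    have := submodule_sub (subquo_botP d) h Bxy.
    by rewrite opprB addrC addrA subrK.
  have := submodule_add (subquo_botP d) Bxy h.
  by rewrite addrA subrK.
rewrite (eq_choose eqP); apply: choose_id; apply/asboolP; last first.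
  by rewrite subrr; case: (subquo_botP d).
by rewrite -opprB -scaleN1r; exact: submodule_scale (subquo_botP d) Bxy.
Qed.

Lemma coset_repr_top x : T x -> T (coset_repr x).
Proof.
move=> Tx; have /subquo_sub Tr := coset_reprP x.
by have := submodule_sub (subquo_topP d) Tx Tr; rewrite subKr.
Qed.

Lemma coset_repr_id x : coset_repr (coset_repr x) = coset_repr x.
Proof.
apply/esym/coset_repr_eq; exact: coset_reprP.
Qed.

(** Cosets are encoded by their canonical representatives, so equality of cosets is plain
    equality. *)
Definition subquo : Type := {x : W | `[< T x /\ coset_repr x = x >]}.
HB.instance Definition _ := Choice.on subquo.

Fact subquo_pi_subproof x : T x ->
  `[< T (coset_repr x) /\ coset_repr (coset_repr x) = coset_repr x >].
Proof. by move=> Tx; apply/asboolP; split; [exact: coset_repr_top|exact: coset_repr_id]. Qed.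

(** The projection is total, as [hom_on] expects; vectors outside the top submodule are sent to the
    class of [0]. *)
Definition subquo_pi (x : W) : subquo :=
  match pselect (T x) with
  | left Tx => exist _ (coset_repr x) (subquo_pi_subproof Tx)
  | right _ => exist _ (coset_repr 0) (subquo_pi_subproof (proj1 (subquo_topP d)))
  end.

Lemma val_subquo_pi x : T x -> val (subquo_pi x) = coset_repr x.
Proof. by move=> Tx; rewrite /subquo_pi; case: pselect. Qed.

Lemma subquo_piP (u : subquo) : exists2 x, T x & u = subquo_pi x.
Proof.
case: u => x Px; have [Tx xr] := asboolP _ Px.
by exists x => //; apply: val_inj; rewrite val_subquo_pi.
Qed.

Lemma subquo_pi_eq x y : T x -> T y -> subquo_pi x = subquo_pi y <-> B (x - y).
Proof.
move=> Tx Ty; split=> [/(congr1 val)|Bxy]; last first.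
  by apply: val_inj; rewrite !val_subquo_pi //; exact: coset_repr_eq.
rewrite !val_subquo_pi // => eqr.
have := submodule_sub (subquo_botP d) (coset_reprP x) (coset_reprP y).
by rewrite eqr opprB addrA subrK.
Qed.

Definition subquo_lift (op : W -> W) (u : subquo) : subquo := subquo_pi (op (val u)).
Definition subquo_add (u v : subquo) : subquo := subquo_pi (val u + val v).

Lemma subquo_liftE (op : W -> W) x :
  {morph op : x y / x - y} -> (forall x, T x -> T (op x)) ->
  (forall x, B x -> B (op x)) -> T x ->
  subquo_lift op (subquo_pi x) = subquo_pi (op x).
Proof.
move=> opB opT opS Tx; rewrite /subquo_lift val_subquo_pi //; apply/subquo_pi_eq.
- by apply: opT; exact: coset_repr_top.
- exact: opT.
by rewrite -opB; apply: opS; rewrite -opprB -scaleN1r;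
  apply: submodule_scale (subquo_botP d) _; exact: coset_reprP.
Qed.

Lemma subquo_addE x y : T x -> T y ->
  subquo_add (subquo_pi x) (subquo_pi y) = subquo_pi (x + y).
Proof.
move=> Tx Ty; rewrite /subquo_add !val_subquo_pi //; apply/esym/subquo_pi_eq.
- exact: submodule_add (subquo_topP d) _ _.
- by apply: submodule_add (subquo_topP d) _ _; exact: coset_repr_top.
by rewrite opprD addrACA; apply: submodule_add (subquo_botP d) _ _; exact: coset_reprP.
Qed.

Definition subquo_opp := subquo_lift -%R.
Definition subquo_scale (a : C) := subquo_lift ( *:%R a).

Lemma subquo_oppE x : T x -> subquo_opp (subquo_pi x) = subquo_pi (- x).
Proof.
apply: subquo_liftE => [u v|u Tu|u Bu]; first by rewrite opprD.
  by rewrite -scaleN1r; exact: submodule_scale (subquo_topP d) _.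
by rewrite -scaleN1r; exact: submodule_scale (subquo_botP d) _.
Qed.

Lemma subquo_scaleE a x : T x -> subquo_scale a (subquo_pi x) = subquo_pi (a *: x).
Proof.
apply: subquo_liftE => [u v|u Tu|u Bu]; first by rewrite scalerBr.
  exact: submodule_scale (subquo_topP d) _.
exact: submodule_scale (subquo_botP d) _.
Qed.

Let TD x y : T x -> T y -> T (x + y). Proof. exact: submodule_add (subquo_topP d). Qed.
Let TZ a x : T x -> T (a *: x). Proof. exact: submodule_scale (subquo_topP d). Qed.
Let TN x : T x -> T (- x). Proof. by rewrite -scaleN1r; exact: TZ. Qed.
Let T0 : T 0. Proof. by case: (subquo_topP d). Qed.

Lemma subquo_addA : associative subquo_add.
Proof.
move=> u v w; have [x Tx ->] := subquo_piP u; have [y Ty ->] := subquo_piP v.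
have [z Tz ->] := subquo_piP w.
by rewrite !subquo_addE ?addrA //; exact: TD.
Qed.

Lemma subquo_addC : commutative subquo_add.
Proof. by move=> u v; rewrite /subquo_add addrC. Qed.

Lemma subquo_add0 : left_id (subquo_pi 0) subquo_add.
Proof. by move=> u; have [x Tx ->] := subquo_piP u; rewrite subquo_addE ?add0r. Qed.

Lemma subquo_addN : left_inverse (subquo_pi 0) subquo_opp subquo_add.
Proof.
move=> u; have [x Tx ->] := subquo_piP u.
by rewrite subquo_oppE // subquo_addE ?addNr //; exact: TN.
Qed.

HB.instance Definition _ := GRing.isZmodule.Build subquo
  subquo_addA subquo_addC subquo_add0 subquo_addN.

Lemma subquo_scaleA a b u :
  subquo_scale a (subquo_scale b u) = subquo_scale (a * b) u.
Proof.
have [x Tx ->] := subquo_piP u.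
by rewrite !subquo_scaleE ?scalerA //; exact: TZ.
Qed.

Lemma subquo_scale1 : left_id 1 subquo_scale.
Proof. by move=> u; have [x Tx ->] := subquo_piP u; rewrite subquo_scaleE ?scale1r. Qed.

Lemma subquo_scaleDr : right_distributive subquo_scale +%R.
Proof.
move=> a u v; have [x Tx ->] := subquo_piP u; have [y Ty ->] := subquo_piP v.
rewrite [LHS](congr1 (subquo_scale a) (subquo_addE Tx Ty)) !subquo_scaleE //; last exact: TD.
by rewrite scalerDr [RHS]subquo_addE //; exact: TZ.
Qed.

Lemma subquo_scaleDl u : {morph subquo_scale^~ u : a b / a + b}.
Proof.
move=> a b; have [x Tx ->] := subquo_piP u.
rewrite !subquo_scaleE // scalerDl [RHS]subquo_addE //; exact: TZ.
Qed.

HB.instance Definition _ := GRing.Zmodule_isLmodule.Build C subquo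
  subquo_scaleA subquo_scale1 subquo_scaleDr subquo_scaleDl.

Lemma subquo_pi_lin a x y : T x -> T y ->
  subquo_pi (a *: x + y) = a *: subquo_pi x + subquo_pi y.
Proof.
move=> Tx Ty; rewrite [_ *: _ in RHS](subquo_scaleE a Tx) [RHS]subquo_addE //.
exact: TZ.
Qed.

Lemma subquo_pi_sub x y : T x -> T y -> subquo_pi (x - y) = subquo_pi x - subquo_pi y.
Proof. by move=> Tx Ty; rewrite addrC -scaleN1r subquo_pi_lin // scaleN1r addrC. Qed.

Let op_lift (op : W -> W) x : linear op -> (forall x, T x -> T (op x)) ->
  (forall x, B x -> B (op x)) -> T x ->
  subquo_lift op (subquo_pi x) = subquo_pi (op x).
Proof. by move=> lin opT opS Tx; apply: subquo_liftE => //; exact: linear_eqB. Qed.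

Lemma subquo_lift_lin (op : W -> W) a u v : linear op -> (forall x, T x -> T (op x)) ->
  (forall x, B x -> B (op x)) ->
  subquo_lift op (a *: u + v) = a *: subquo_lift op u + subquo_lift op v.
Proof.
move=> lin opT opS; have [x Tx ->] := subquo_piP u; have [y Ty ->] := subquo_piP v.
rewrite -subquo_pi_lin // !op_lift // ?lin ?subquo_pi_lin //; try exact: opT.
by apply: TD => //; exact: TZ.
Qed.

Let eT x (Tx : T x) : T (act_e x). Proof. by case: (subquo_topP d) => _ [_ /(_ x Tx)[]]. Qed.
Let fT x (Tx : T x) : T (act_f x). Proof. by case: (subquo_topP d) => _ [_ /(_ x Tx)[_ []]]. Qed.
Let hT x (Tx : T x) : T (act_h x). Proof. by case: (subquo_topP d) => _ [_ /(_ x Tx)[_ []]]. Qed.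
Let eB x (Bx : B x) : B (act_e x). Proof. by case: (subquo_botP d) => _ [_ /(_ x Bx)[]]. Qed.
Let fB x (Bx : B x) : B (act_f x). Proof. by case: (subquo_botP d) => _ [_ /(_ x Bx)[_ []]]. Qed.
Let hB x (Bx : B x) : B (act_h x). Proof. by case: (subquo_botP d) => _ [_ /(_ x Bx)[_ []]]. Qed.

Let eE x (Tx : T x) : subquo_lift (@act_e W) (subquo_pi x) = subquo_pi (act_e x).
Proof. exact: op_lift (@linear_act_e W) eT eB Tx. Qed.
Let fE x (Tx : T x) : subquo_lift (@act_f W) (subquo_pi x) = subquo_pi (act_f x).
Proof. exact: op_lift (@linear_act_f W) fT fB Tx. Qed.
Let hE x (Tx : T x) : subquo_lift (@act_h W) (subquo_pi x) = subquo_pi (act_h x).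
Proof. exact: op_lift (@linear_act_h W) hT hB Tx. Qed.

Fact subquo_he u : subquo_lift (@act_h W) (subquo_lift (@act_e W) u)
  - subquo_lift (@act_e W) (subquo_lift (@act_h W) u) = 2%:R *: subquo_lift (@act_e W) u.
Proof.
have [x Tx ->] := subquo_piP u.
rewrite (eE Tx) (hE Tx) (hE (eT Tx)) (eE (hT Tx)).
rewrite -(subquo_pi_sub (hT (eT Tx)) (eT (hT Tx))) rel_he.
exact/esym/(subquo_scaleE _ (eT Tx)).
Qed.

Fact subquo_hf u : subquo_lift (@act_h W) (subquo_lift (@act_f W) u)
  - subquo_lift (@act_f W) (subquo_lift (@act_h W) u)
  = - (2%:R *: subquo_lift (@act_f W) u).
Proof.
have [x Tx ->] := subquo_piP u.
rewrite (fE Tx) (hE Tx) (hE (fT Tx)) (fE (hT Tx)).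
rewrite -(subquo_pi_sub (hT (fT Tx)) (fT (hT Tx))) rel_hf -!scaleNr.
exact/esym/(subquo_scaleE _ (fT Tx)).
Qed.

Fact subquo_ef u : subquo_lift (@act_e W) (subquo_lift (@act_f W) u)
  - subquo_lift (@act_f W) (subquo_lift (@act_e W) u) = subquo_lift (@act_h W) u.
Proof.
have [x Tx ->] := subquo_piP u.
rewrite (fE Tx) (eE Tx) (hE Tx) (eE (fT Tx)) (fE (eT Tx)).
by rewrite -(subquo_pi_sub (eT (fT Tx)) (fT (eT Tx))) rel_ef.
Qed.

Definition subquo_sl2mod : sl2mod := @Sl2Mod subquo
  (subquo_lift (@act_e W)) (subquo_lift (@act_f W)) (subquo_lift (@act_h W))
  (fun a u v => subquo_lift_lin a u v (@linear_act_e W) eT eB)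
  (fun a u v => subquo_lift_lin a u v (@linear_act_f W) fT fB)
  (fun a u v => subquo_lift_lin a u v (@linear_act_h W) hT hB)
  subquo_he subquo_hf subquo_ef.

Lemma subquotient_exists : exists (X : sl2mod) (g : W -> X),
  [/\ hom_on T g, forall z, exists2 v, T v & g v = z
    & forall v, T v -> (g v = 0 <-> B v)].
Proof.
exists subquo_sl2mod, subquo_pi; split.
- split=> [a x y|x Tx]; first exact: subquo_pi_lin.
  by split; [|split]; apply/esym; [exact: eE|exact: fE|exact: hE].
- by move=> z; have [v Tv ->] := subquo_piP z; exists v.
move=> v Tv; have := subquo_pi_eq Tv T0; rewrite subr0; exact.
Qed.

End Subquotient.

(** * The Casimir operator *)

Lemma poly_infinite_roots (D : idomainType) (p : {poly D}) (r : nat -> D) :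
  injective r -> (forall n, root p (r n)) -> p = 0.
Proof.
move=> inj rp; apply/eqP; apply: contraT => p0.
have := @max_poly_roots _ p (mkseq r (size p)) p0.
rewrite size_mkseq ltnn; apply.
  by apply/allP => x /mapP[i _ ->].
exact: mkseq_uniq.
Qed.

Lemma casimirE (W : sl2mod) (v : W) :
  casimir_op v = L0 (L0 v) - L0 v + act_f (act_e v).
Proof. by rewrite /casimir_op /Lm1 /L1 (linear_eqN (@linear_act_f W)) [- - act_f _]opprK. Qed.

Lemma act_hE2 (W : sl2mod) (v : W) : act_h v = - (L0 v + L0 v).
Proof. by rewrite act_hE mulr2n scalerDl scale1r. Qed.

(** Substitute [f e = e f - h = e f + 2 z]. Together with [casimirE] this shows that the Casimir is
    [z^2 - z] on the kernel of [e] and [z^2 + z] on the kernel of [f]. *)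
Lemma casimirE2 (W : sl2mod) (v : W) :
  casimir_op v = L0 (L0 v) + L0 v + act_e (act_f v).
Proof.
rewrite casimirE; have /eqP := rel_ef v; rewrite subr_eq act_hE2 => /eqP->.
by rewrite [RHS]addrA opprD [in RHS]addrA addrK.
Qed.

Lemma casimir_e (W : sl2mod) (v : W) : casimir_op (act_e v) = act_e (casimir_op v).
Proof.
have eD := linear_eqD (@linear_act_e W); have eB := linear_eqB (@linear_act_e W).
rewrite !casimirE eD eB; set y := L0 (act_e v).
have -> : L0 y = act_e (L0 (L0 v)) - act_e (L0 v) - y.
  by rewrite /y L0_e (linear_eqB (@L0_linear W)) !L0_e.
have /eqP := rel_ef (act_e v); rewrite subr_eq act_hE2 -/y => /eqP->.
by rewrite addrA -[_ - y - y]addrA -opprD.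
Qed.

Lemma casimir_f (W : sl2mod) (v : W) : casimir_op (act_f v) = act_f (casimir_op v).
Proof.
have fD := linear_eqD (@linear_act_f W); have fB := linear_eqB (@linear_act_f W).
rewrite !casimirE fD fB; set y := L0 (act_f v).
have -> : L0 y = act_f (L0 (L0 v)) + act_f (L0 v) + y.
  by rewrite /y L0_f (linear_eqD (@L0_linear W)) !L0_f.
have /eqP := rel_ef v; rewrite subr_eq act_hE2 => /eqP->.
by rewrite fD (linear_eqN (@linear_act_f W)) fD addrK opprD addrA addrA addrK.
Qed.

Lemma casimir_L0 (W : sl2mod) (v : W) : casimir_op (L0 v) = L0 (casimir_op v).
Proof.
rewrite !casimirE (linear_eqD (@L0_linear W)) (linear_eqB (@L0_linear W)).
rewrite [L0 (act_f _)]L0_f L0_e (linear_eqB (@linear_act_f W)).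
by rewrite subrK.
Qed.

Lemma casimir_linear (W : sl2mod) : linear (@casimir_op W).
Proof.
move=> a x y; rewrite !casimirE act_e_lin act_f_lin !L0_linear.
by rewrite [in RHS]scalerDr scalerBr [RHS]addrACA; congr (_ + _); rewrite [RHS]addrACA -opprD.
Qed.

Lemma casimir_h (W : sl2mod) (v : W) : casimir_op (act_h v) = act_h (casimir_op v).
Proof.
by rewrite !act_hE (linear_eqN (@casimir_linear W)) (linear_eqZ _ (@casimir_linear W)) casimir_L0.
Qed.

Definition zcasimir (W : sl2mod) : zmodule_of W -> zmodule_of W := @casimir_op W.

(** Linearity is over [{poly C}] here, and comes from the commutation with [L0]. *)
Lemma zcasimir_linear (W : sl2mod) : linear (@zcasimir W).
Proof.
move=> p x y; rewrite /zcasimir [LHS](linear_eqD (@casimir_linear W)); congr (_ + _).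
exact: (poly_op_comm p x (@casimir_linear W) (@casimir_L0 W)).
Qed.

(** Among the first [size vs + 1] iterates on a vector there is a relation, so each vector has an
    annihilator. The product over a spanning family kills all of [W] by torsion-freeness. *)
Lemma casimir_annihilator (W : sl2mod) : rational_mod W ->
  exists2 P : {poly {poly C}}, P != 0 & forall w : W, poly_op (@zcasimir W) P w = 0.
Proof.
move=> /rational_modP[tf _ [vs span]].
have lin := @zcasimir_linear W.
have ann1 (v : zmodule_of W) : exists2 P, P != 0 & poly_op (@zcasimir W) P v = 0.
  have [||q [k kl qk] eq0] := @steinitz {poly C} (zmodule_of W) vs
    (mkseq (fun i => iter i (@zcasimir W) v) (size vs).+1).
  - by [].
  - by rewrite size_mkseq.
  rewrite size_mkseq in kl.
  exists (\poly_(i < (size vs).+1) q i).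
    apply: contraNneq qk => /(congr1 (fun P : {poly {poly C}} => P`_k)).
    by rewrite coef_poly kl coef0 => ->.
  rewrite (poly_opE _ _ (size_poly _ _)) -[RHS]eq0 /lincomb size_mkseq.
  by apply: eq_bigr => i _; rewrite coef_poly ltn_ord nth_mkseq.
have [P P0 Pvs] : exists2 P, P != 0 &
    forall k, (k < size vs)%N -> poly_op (@zcasimir W) P vs`_k = 0.
  elim: vs {span} => [|v vs [P P0 IH]]; first by exists 1; rewrite ?oner_eq0.
  have [Q Q0 Qv] := ann1 v; exists (P * Q); first by rewrite mulf_neq0.
  case=> [_|k /IH kl] /=; first by rewrite poly_opM // Qv (linear_eq0 (poly_op_linear _ lin)).
  by rewrite mulrC poly_opM // kl (linear_eq0 (poly_op_linear _ lin)).
exists P => // w; have [d d0 [q qE]] := span w; apply: (tf d) => //.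
rewrite polyactE -(linear_eqZ d (poly_op_linear P lin)) qE /lincomb.
rewrite (big_morph _ (linear_eqD (poly_op_linear P lin)) (linear_eq0 (poly_op_linear P lin))).
apply: big1 => i _.
by rewrite (linear_eqZ _ (poly_op_linear P lin)) Pvs // scaler0.
Qed.

Lemma poly_op_eigen (K : comNzRingType) (V : lmodType K) (phi : V -> V) p a v :
  linear phi -> phi v = a *: v -> poly_op phi p v = p.[a] *: v.
Proof.
move=> lin phiv; elim/poly_ind: p => [|p c IH]; first by rewrite poly_op0 horner0 scale0r.
rewrite poly_opD poly_opMX poly_opC phiv (linear_eqZ _ (poly_op_linear _ lin)) IH.
by rewrite !hornerE scalerDl scalerA mulrC.
Qed.

(** Each eigenvalue in [{poly C}] is a root of the annihilator, which has finitely many roots. *)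
Lemma casimir_eigenvalues_finite (W : sl2mod) (r : nat -> {poly C})
  (w : nat -> zmodule_of W) : rational_mod W -> injective r ->
  (forall n, w n <> 0) -> (forall n, zcasimir (w n) = r n *: w n) -> False.
Proof.
move=> rW inj wn0 cw; have [P P0 Pw] := casimir_annihilator rW.
have /rational_modP[tf _ _] := rW.
move/eqP: P0; apply; apply: (poly_infinite_roots inj) => n.
apply/rootP/eqP; apply: contraT => Pr; case: (wn0 n); apply: (tf P.[r n]) => //.
by rewrite polyactE -(poly_op_eigen _ (@zcasimir_linear W) (cw n)); exact: Pw.
Qed.

(* If g v = 0, the vectors k^n v would be Casimir eigenvectors with pairwise
   distinct eigenvalues (z + s n)(z + s (n+1)). *)
Lemma ladder_injective (W : sl2mod) (g k : zmodule_of W -> zmodule_of W) (s : C) :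
  s != 0 -> rational_mod W ->
  (forall v, g v = 0 -> zcasimir v = ('X^2 + s%:P * 'X) *: v) ->
  (forall v, k v = 0 -> zcasimir v = ('X^2 - s%:P * 'X) *: v) ->
  (forall p v, k (p *: v) = shift s p *: k v) ->
  (forall v, zcasimir (k v) = k (zcasimir v)) ->
  forall v, g v = 0 -> v = 0.
Proof.
move=> s0 rW gker kker kZ kC v gv; apply/eqP; apply: contraT => /eqP v0.
pose r (n : nat) : {poly C} := ('X + s%:P * n%:R) * ('X + s%:P * n.+1%:R).
have rE n : r n = 'X^2 + (s * (n + n).+1%:R) *: 'X + (s ^+ 2 * (n * n.+1)%:R)%:P.
  rewrite /r -mul_polyC !polyCM !polyC_natr -!natr1 !natrM -!natr1 !natrD; ring.
have r1 n : (r n)`_1 = s * (n + n).+1%:R.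
  by rewrite rE !coefD coefXn coefZ coefX coefC /= add0r addr0 mulr1.
have /rational_modP[tf _ _] := rW.
have H n : iter n k v <> 0 /\ zcasimir (iter n k v) = r n *: iter n k v.
  elim: n => [|n [w0 cw]] /=.
    split=> //; rewrite gker //; congr (_ *: _); rewrite /r; ring.
  split; last first.
    rewrite kC cw kZ; congr (_ *: _); rewrite /r /shift comp_polyM !comp_polyD !comp_polyM.
    rewrite !comp_polyX !comp_polyC -!polyC_natr !comp_polyC -!natr1 !polyCD; ring.
  (* If [k] killed the [n]-th vector, that vector would have a second eigenvalue [X^2 - s X]. The
     linear coefficients differ by [s (2 n + 2)], which is nonzero, so torsion-freeness forces the
     vector to vanish. *)
  move=> /kker; rewrite cw => /eqP; rewrite -subr_eq0 -scalerBl => /eqP h.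
  apply: w0; apply: (tf (r n - ('X^2 - s%:P * 'X))); last exact: h.
  apply: contraTneq isT => /(congr1 (fun p : {poly C} => p`_1)) /eqP.
  rewrite !coefB r1 coefXn coefCM coefX coef0 /= sub0r opprK mulr1.
  by rewrite -[X in _ + X]mulr1 -mulrDr natr1 mulf_eq0 (negPf s0) (negPf (C_natr_neq0 _)).
case: (@casimir_eigenvalues_finite W r (fun n => iter n k v) rW).
- move=> m n /(congr1 (fun p : {poly C} => p`_1)); rewrite !r1 => /(mulfI s0)/C_natr_inj.
  by move=> [/(congr1 half)]; rewrite !addnn !doubleK.
- by move=> n; case: (H n).
- by move=> n; case: (H n).
Qed.

(** A vector killed by [e] is moved along its ladder by [f], which replaces [z] by [z - 1]; hence
    [s = -1]. *)
Lemma act_e_injective (W : sl2mod) (v : W) : rational_mod W -> act_e v = 0 -> v = 0.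
Proof.
move=> rW; have m1 : (-1 : C) != 0 by rewrite oppr_eq0 oner_eq0.
apply: (@ladder_injective W (@act_e W) (@act_f W) (-1) m1 rW) => [u|u|p u|u].
- move=> eu; rewrite /zcasimir casimirE eu (linear_eq0 (@linear_act_f W)) addr0.
  by rewrite polyCN mulN1r scalerBl expr2 -scalerA -!L0_scale.
- move=> fu; rewrite /zcasimir casimirE2 fu (linear_eq0 (@linear_act_e W)) addr0.
  by rewrite polyCN mulN1r opprK scalerDl expr2 -scalerA -!L0_scale.
- exact: polyact_f.
- exact: casimir_f.
Qed.

Lemma act_f_injective (W : sl2mod) (v : W) : rational_mod W -> act_f v = 0 -> v = 0.
Proof.
move=> rW; have m1 : (1 : C) != 0 by rewrite oner_eq0.
apply: (@ladder_injective W (@act_f W) (@act_e W) 1 m1 rW) => [u|u|p u|u].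
- move=> fu; rewrite /zcasimir casimirE2 fu (linear_eq0 (@linear_act_e W)) addr0.
  by rewrite mul1r scalerDl expr2 -scalerA -!L0_scale.
- move=> eu; rewrite /zcasimir casimirE eu (linear_eq0 (@linear_act_f W)) addr0.
  by rewrite mul1r scalerBl expr2 -scalerA -!L0_scale.
- exact: polyact_e.
- exact: casimir_e.
Qed.

(** * A shift-invariant annihilator of the Casimir, and irreducible modules *)

Definition shift_coefs (P : {poly {poly C}}) : {poly {poly C}} :=
  map_poly (comp_poly ('X - 1%:P)) P.

Lemma size_shift (p : {poly C}) : size (p \Po ('X - 1%:P)) = size p.
Proof. by rewrite size_comp_poly2 ?size_XsubC. Qed.

Lemma lead_coef_shift (p : {poly C}) : lead_coef (p \Po ('X - 1%:P)) = lead_coef p.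
Proof. by rewrite lead_coef_comp ?size_XsubC // lead_coefXsubC expr1n mulr1. Qed.

(** Invariance gives [p] the same value at [0], [-1], [-2], and so on, so [p - p(0)] has infinitely
    many roots. *)
Lemma shift_invariant (p : {poly C}) : p \Po ('X - 1%:P) = p -> p = (p.[0])%:P.
Proof.
move=> inv; apply/eqP; rewrite -subr_eq0; apply/eqP.
apply: (@poly_infinite_roots _ _ (fun n => - n%:R)).
  by move=> m n /oppr_inj/C_natr_inj.
suff pn n : p.[- n%:R] = p.[0].
  by move=> n; rewrite /root hornerD hornerN hornerC pn subrr.
elim: n => [|n <-]; first by rewrite oppr0.
by rewrite -{2}inv horner_comp !hornerE -opprD natr1.
Qed.

(** Write [P'] for the shifted polynomial and [c] for the Casimir. Then [f e P'(c) w = P'(c) f e w =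
    f P(c) e w = 0], and [f e] is injective. The first equality uses that the shifts of [e] and [f]
    cancel, so [f e] is linear over [{poly C}]. *)
Lemma shift_coefs_annihilator (W : sl2mod) P : rational_mod W ->
  (forall w : W, poly_op (@zcasimir W) P w = 0) ->
  forall w : W, poly_op (@zcasimir W) (shift_coefs P) w = 0.
Proof.
move=> rW Pw w; apply: (act_e_injective rW); apply: (act_f_injective rW).
have gl : linear (fun v : zmodule_of W => act_f (act_e v) : zmodule_of W).
  move=> p x y; rewrite (linear_eqD (@linear_act_e W)) (linear_eqD (@linear_act_f W)).
  rewrite -!polyactE polyact_e polyact_f; congr (polyact _ _ + _).
  rewrite /shift -comp_polyA comp_polyD comp_polyX comp_polyC.
  by rewrite polyCN subrK comp_polyXr.
rewrite (poly_op_comm _ _ gl); last by move=> v; rewrite /zcasimir -casimir_e -casimir_f.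
have iterC n x : act_f (iter n (@zcasimir W) x) = iter n (@zcasimir W) (act_f x : W).
  by elim: n => //= n <-; rewrite /zcasimir casimir_f.
rewrite -[RHS](linear_eq0 (@linear_act_f W)) -(Pw (act_e w)).
rewrite /shift_coefs (@poly_opE _ _ _ (size P)) ?size_poly //.
rewrite /poly_op (big_morph _ (linear_eqD (@linear_act_f W)) (linear_eq0 (@linear_act_f W))).
apply: eq_bigr => i _; rewrite coef_map -!polyactE polyact_f /shift polyCN; congr (polyact _ _).
exact/esym/iterC.
Qed.

Lemma minimal_annihilator (W : sl2mod) : rational_mod W ->
  exists P : {poly {poly C}}, [/\ P != 0, forall w : W, poly_op (@zcasimir W) P w = 0,
    shift_coefs P = P &
    forall Q : {poly {poly C}}, Q != 0 -> (size Q < size P)%N ->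
      exists w : W, poly_op (@zcasimir W) Q w <> 0].
Proof.
move=> rW; pose kills (P : {poly {poly C}}) :=
  P != 0 /\ forall w : W, poly_op (@zcasimir W) P w = 0.
have [P0 P00 P0w] := casimir_annihilator rW.
have ex1 : exists n, `[< exists2 P, kills P & size P = n >].
  by exists (size P0); apply/asboolP; exists P0.
have [m /asboolP[P1 kP1 sP1] minm] := ex_minnP ex1.
have ex2 : exists n, `[< exists2 P, kills P & size P = m /\ size (lead_coef P) = n >].
  by exists (size (lead_coef P1)); apply/asboolP; exists P1.
have [k /asboolP[P [Pn0 kP] [sP lP]] mink] := ex_minnP ex2.
have minP (Q : {poly {poly C}}) : Q != 0 -> (size Q < size P)%N ->
    exists w : W, poly_op (@zcasimir W) Q w <> 0.
  move=> Q0 lt; apply: contrapT => nex; move: lt; rewrite sP ltnNge; apply/negP/negPn.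
  apply: minm; apply/asboolP; exists Q => //; split=> // w.
  by apply: contrapT => Qw; apply: nex; exists w.
(* A nonzero difference [shift_coefs P - P] would be an annihilator of the same minimal size, with a
   leading coefficient of smaller size. *)
exists P; split=> //; apply/eqP; rewrite -subr_eq0; apply: contraT => D0.
have kD : kills (shift_coefs P - P).
  split=> // w; rewrite -scaleN1r poly_opD poly_opZ kP scaler0 addr0.
  exact: shift_coefs_annihilator.
have sD : size (shift_coefs P - P) = m.
  apply/eqP; rewrite eqn_leq minm ?andbT; last first.
    by apply/asboolP; exists (shift_coefs P - P).
  rewrite (leq_trans (size_polyD _ _)) // size_polyN sP geq_max leqnn andbT.
  by rewrite -sP size_poly.
have kl : (k <= size (lead_coef (shift_coefs P - P)))%N.
  by apply: mink; apply/asboolP; exists (shift_coefs P - P).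
suff : (size (lead_coef (shift_coefs P - P)) < k)%N by rewrite ltnNge kl.
have lc : lead_coef (shift_coefs P - P) = lead_coef P \Po ('X - 1%:P) - lead_coef P.
  by rewrite !lead_coefE sD -sP coefB coef_map.
rewrite lc -lP; set a := lead_coef P; have a0 : a != 0 by rewrite lead_coef_eq0.
have sa : (0 < size a)%N by rewrite size_poly_gt0.
(* Shifting preserves the size and the top coefficient of [a], so the coefficient of index
   [(size a).-1] cancels and all higher ones vanish. *)
rewrite -[X in (_ < X)%N](prednK sa) ltnS; apply/leq_sizeP => j.
rewrite leq_eqVlt => /orP[/eqP<-|lt]; rewrite coefB.
  by have := lead_coef_shift a; rewrite !lead_coefE size_shift => ->; rewrite subrr.
by rewrite !nth_default ?subrr ?size_shift //; rewrite -ltnS prednK // in lt.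
Qed.

Lemma irreducible_casimir (W : sl2mod) : R_irreducible W -> casimir W.
Proof.
move=> [rW [[w0 w0n] irr]]; have [tf _ _] := (rational_modP W).1 rW.
have [P [P0 kP shP minP]] := minimal_annihilator rW.
have lin := @zcasimir_linear W; have clin := @casimir_linear W.
(* The coefficients of [P] are shift-invariant, hence constants, and evaluation at [0] recovers
   them. *)
pose q : {poly C} := map_poly (horner_eval 0) P.
have PE : P = map_poly polyC q.
  apply/polyP => i; rewrite !coef_map /=; apply: shift_invariant.
  by rewrite -{2}shP coef_map.
(* A nonzero constant annihilator would kill [w0], against torsion-freeness. *)
have sq : size q != 1%N.
  have -> : size q = size P.
    by rewrite -(size_map_inj_poly (@polyC_inj C) (erefl _) q) -PE.
  apply/negP => /eqP/eqP/size_poly1P[c c0 Pc]; apply: w0n; apply: (tf c) => //.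
  by rewrite -(kP w0) Pc poly_opC.
have [r /factor_theorem[q' qE]] : exists r, root q r.
  exact: elimT (@closed_rootP (Rdefinitions.R)[i] q) sq.
pose P' : {poly {poly C}} := map_poly polyC q'.
have PE' : P = ('X - r%:P%:P) * P'.
  by rewrite PE qE rmorphM rmorphB /= map_polyX map_polyC mulrC.
have P'0 : P' != 0 by apply: contraNneq P0 => h; rewrite PE' h mulr0.
(* [P'] is smaller than [P], so it does not annihilate [W]; any nonzero value of it is an
   eigenvector for [r]. *)
have [|w Pw] := minP P' P'0.
  by rewrite PE' size_monicM ?monicXsubC // size_XsubC.
pose u : W := poly_op (@zcasimir W) P' (w : zmodule_of W).
have cu : casimir_op u = r *: u.
  apply/eqP; rewrite -subr_eq0; apply/eqP.
  have := kP w; rewrite PE' poly_opM // poly_opD poly_opX -polyCN poly_opC scaleNr => h.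
  by rewrite polyC_scale; exact: h.
have [|all0|all] := irr (fun v : W => casimir_op v = r *: v).
- apply/rational_submoduleP => //; split; last first.
    move=> p v p0 h; apply/eqP; rewrite -subr_eq0; apply/eqP/(tf p) => //.
    have := linear_eqZ p lin v; rewrite /zcasimir [LHS]h => h'.
    rewrite polyactE scalerBr -h' polyC_scale polyactE polyC_scale !scalerA mulrC.
    by rewrite subrr.
  split; first by rewrite (linear_eq0 clin) scaler0.
  split=> [a x y cx cy|x cx].
    by rewrite clin cx cy scalerDr !scalerA mulrC.
  rewrite casimir_e casimir_f casimir_h cx.
  rewrite (linear_eqZ _ (@linear_act_e W)) (linear_eqZ _ (@linear_act_f W)).
  by rewrite (linear_eqZ _ (@linear_act_h W)).
- by case: Pw; exact: (all0 u).
by exists r.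
Qed.

(** * Jordan-Hoelder theory *)

Definition factor (W : sl2mod) (S T : W -> Prop) (X : sl2mod) (g : W -> X) : Prop :=
  [/\ forall v, S v -> T v, hom_on T g, forall z, exists2 v, T v & g v = z,
      forall v, T v -> (g v = 0 <-> S v) & R_irreducible X].

(** Inductive form of [comp_series], ending at any submodule instead of [W]. The list records the
    factors from bottom to top, which permits induction without indexed families. *)
Inductive series (W : sl2mod) : (W -> Prop) -> seq sl2mod -> Prop :=
| series_nil S : (forall v, S v <-> v = 0) -> series S [::]
| series_rcons S T (X : sl2mod) (g : W -> X) l :
    series S l -> sat_submodule T -> factor S T g -> series T (rcons l X).

Definition unit_fsum (l : seq sl2mod) : fsum := [seq (1%:Z, X) | X <- l].

Lemma coef_cat s t X : coef (s ++ t) X = coef s X + coef t X.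
Proof. by elim: s => [|p s IH] /=; rewrite ?add0r // IH addrA. Qed.

Lemma coef_unit_rcons l Y X :
  coef (unit_fsum (rcons l Y)) X = coef (unit_fsum l) X + (if `[< iso Y X >] then 1 else 0).
Proof. by rewrite /unit_fsum map_rcons -cats1 coef_cat /= addr0. Qed.

Lemma series_ext (W : sl2mod) (S T : W -> Prop) l :
  (forall v, S v <-> T v) -> series S l -> series T l.
Proof. by move=> ST; suff -> : S = T by []; apply/funext => v; exact/propext. Qed.

Lemma factor_neq0 (W : sl2mod) (S T : W -> Prop) (X : sl2mod) (g : W -> X) :
  factor S T g -> exists2 v, T v & ~ S v.
Proof.
move=> [_ _ surj ker [_ [[z z0] _]]]; have [v Tv gv] := surj z.
by exists v => // /(ker _ Tv); rewrite gv.
Qed.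

Lemma iso_asbool_l (X Y Z : sl2mod) : iso X Y -> `[< iso X Z >] = `[< iso Y Z >].
Proof.
move=> XY; apply/asboolP/asboolP; first exact/iso_trans/iso_sym.
exact: iso_trans.
Qed.

Section RationalAmbient.
Variables (W : sl2mod) (rW : rational_mod W).

Lemma sat_submodule0 (S : W -> Prop) : (forall v, S v <-> v = 0) -> sat_submodule S.
Proof.
move=> /(_ _)/propext S0; have -> : S = fun v => v = 0 by exact/funext.
split; last by move=> p v p0; have [tf _ _] := (rational_modP W).1 rW; exact: tf.
split=> //; split=> [a x y -> ->|x ->]; first by rewrite scaler0 addr0.
by rewrite (linear_eq0 (@linear_act_e W)) (linear_eq0 (@linear_act_f W))
  (linear_eq0 (@linear_act_h W)).
Qed.

Lemma sat_submoduleI (S T : W -> Prop) : sat_submodule S -> sat_submodule T ->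
  sat_submodule (fun v => S v /\ T v).
Proof.
move=> [[S0 [Sl Sa]] cS] [[T0 [Tl Ta]] cT]; split; last first.
  by move=> p v p0 [Sv Tv]; split; [exact: cS Sv | exact: cT Tv].
split=> //; split=> [a x y [Sx Tx] [Sy Ty]|x [Sx Tx]].
  by split; [exact: Sl | exact: Tl].
have [Se [Sf Sh]] := Sa _ Sx; have [Te [Tf Th]] := Ta _ Tx; tauto.
Qed.

Lemma series_sat (T : W -> Prop) l : series T l -> sat_submodule T.
Proof. by case=> // S; exact: sat_submodule0. Qed.

(** The image of [U] is a rational submodule of the irreducible [X]. *)
Lemma factor_im (S T U : W -> Prop) (X : sl2mod) (g : W -> X) :
  submodule T -> sat_submodule U -> (forall v, U v -> T v) -> factor S T g ->
  (forall v, U v -> S v) \/ (forall z, exists2 v, U v & g v = z).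
Proof.
move=> sT satU UT [ST hg surj ker [rX [_ irr]]].
have /irr : rational_submodule (fun z => exists2 v, U v & g v = z).
  by apply/rational_submoduleP => //; exact: (sat_im sT hg).
case=> [im0|]; last by right.
by left=> v Uv; apply/(ker _ (UT _ Uv))/im0; exists v.
Qed.

Lemma factor_maximal (S T U : W -> Prop) (X : sl2mod) (g : W -> X) :
  submodule T -> sat_submodule U -> (forall v, S v -> U v) ->
  (forall v, U v -> T v) -> factor S T g ->
  (forall v, U v <-> S v) \/ (forall v, U v <-> T v).
Proof.
move=> sT satU SU UT fct; have [US|surj] := factor_im sT satU UT fct.
  by left=> v; split; [exact: US|exact: SU].
right=> v; split=> [|Tv]; first exact: UT.
case: fct => _ hg _ ker _; have [u Uu gu] := surj (g v).
have Tu := UT _ Uu; rewrite -[v](subrK u).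
apply: submodule_add (proj1 satU) _ Uu; apply/SU/ker.
  exact: submodule_sub.
by rewrite (homB hg) // gu subrr.
Qed.

(** Second isomorphism theorem: [U / (S meet U)] is presented by the same map as [T / S]. *)
Lemma factor_meet (S T U : W -> Prop) (X : sl2mod) (g : W -> X) :
  submodule T -> sat_submodule U -> (forall v, U v -> T v) -> factor S T g ->
  ~ (forall v, U v -> S v) -> factor (fun v => S v /\ U v) U g.
Proof.
move=> sT satU UT fct nUS; have [//|surj] := factor_im sT satU UT fct.
case: fct => _ hg _ ker irr; split=> //; first by move=> v [].
  exact: hom_on_sub UT.
by move=> v Uv; have := ker _ (UT _ Uv); tauto.
Qed.

(** Induction on the series, with [T1] its penultimate term. If [T1] differs from [S], the induction
    hypothesis for the intersection inside [T1] gives a series of that intersection, and adding [X1]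
    on top makes it a series of [S]: the two top factors trade places. *)
Lemma series_exchange (T : W -> Prop) l : series T l ->
  forall (S : W -> Prop) (Y : sl2mod) (g : W -> Y), sat_submodule S -> factor S T g ->
  exists2 l', series S l' & forall X, coef (unit_fsum l) X =
    coef (unit_fsum l') X + (if `[< iso Y X >] then 1 else 0).
Proof.
elim=> {T l} [T T0|T1 T X1 g1 l1 ser1 IH satT fct1] S Y g satS fct.
  have [v /T0 -> []] := factor_neq0 fct; by case: satS => -[].
have sT := satT.1; have satT1 := series_sat ser1.
have [ST _ _ _ _] := fct; have [T1T _ _ _ _] := fct1.
have [eqS|neS] := pselect (forall v, T1 v <-> S v).
  exists l1; first exact: series_ext ser1.
  move=> X; rewrite coef_unit_rcons (@iso_asbool_l _ Y) //.
  case: fct fct1 => _ hg surj ker _ [_ hg1 surj1 ker1 _].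
  apply: (quotients_iso sT hg1 hg surj1 surj) => v Tv.
  by have := ker v Tv; have := ker1 v Tv; have := eqS v; tauto.
(* By maximality, neither of two distinct maximal submodules contains the other. *)
have nT1S : ~ (forall v, T1 v -> S v).
  move=> sub; have [eq|eq] := factor_maximal sT satS sub ST fct1.
    by apply: neS => v; split=> [/sub|/eq].
  by have [v Tv []] := factor_neq0 fct; apply/eq.
have nST1 : ~ (forall v, S v -> T1 v).
  move=> sub; have [eq|eq] := factor_maximal sT satT1 sub T1T fct.
    by apply: neS => v; exact: eq.
  by have [v Tv []] := factor_neq0 fct1; apply/eq.
have fctm := factor_meet sT satT1 T1T fct nT1S.
have [l' ser' mul'] := IH _ _ _ (sat_submoduleI satS satT1) fctm.
exists (rcons l' X1); last by move=> X; rewrite !coef_unit_rcons mul' addrAC.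
apply: (series_rcons ser' satS (g := g1)).
have [a b c d e] := factor_meet sT satS ST fct1 nST1.
by split=> // [v []//|v Sv]; have := d v Sv; tauto.
Qed.

(** The first series is exchanged for one through the penultimate term of the second, where
    induction applies. *)
Lemma series_unique (T : W -> Prop) l l' : series T l -> series T l' ->
  forall X, coef (unit_fsum l) X = coef (unit_fsum l') X.
Proof.
move=> ser ser'; elim: ser' l ser => {T l'} [T T0|S T Y g l' ser' IH satT fct] l ser.
  case: ser T0 => {T l} // S T X g l ser _ fct T0.
  have [v /T0 -> []] := factor_neq0 fct; by case: (series_sat ser) => -[].
have [l0 ser0 mul0] := series_exchange ser (series_sat ser') fct.
by move=> X; rewrite mul0 coef_unit_rcons (IH _ ser0).
Qed.

End RationalAmbient.

(** * Existence of composition series *)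

Definition independent_in (W : sl2mod) (T : W -> Prop) (us : seq (zmodule_of W)) : Prop :=
  all_of (T : zmodule_of W -> Prop) us /\ ~ @dependent {poly C} (zmodule_of W) us.

Lemma maximal_factor_irreducible (W : sl2mod) (U T : W -> Prop) (X : sl2mod)
  (g : W -> X) us : rational_mod W -> sat_submodule U -> sat_submodule T ->
  (forall v, U v -> T v) -> (exists2 v, T v & ~ U v) ->
  hom_on T g -> (forall z, exists2 v, T v & g v = z) ->
  (forall v, T v -> (g v = 0 <-> U v)) -> independent_in U us ->
  (forall V us', sat_submodule V -> (forall v, V v -> T v) ->
     (exists2 v, T v & ~ V v) -> independent_in V us' -> (size us' <= size us)%N) ->
  R_irreducible X.
Proof.
move=> rW satU satT UT [t Tt nUt] hg surj ker [Uus indep] maxus.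
have rX : rational_mod X := quotient_rational satT.1 hg rW satT satU surj ker.
split=> //; split; first by exists (g t); apply/(ker _ Tt).
move=> S /(rational_submoduleP _ rX) satS.
have satV := sat_preim satT.1 hg satT satS.
have [all|nall] := pselect (forall v, T v -> S (g v)).
  by right=> z; have [v Tv <-] := surj z; exact: all.
have [VU|nVU] := pselect (forall v, T v /\ S (g v) -> U v).
  by left=> z; have [v Tv <-] := surj z => Sz; apply/(ker _ Tv)/VU.
have [x [Vx nUx]] : exists x, (T x /\ S (g x)) /\ ~ U x.
  apply: contrapT => nex; apply: nVU => v Vv; apply: contrapT => nUv.
  by apply: nex; exists v.
(* The preimage of [S] is a proper submodule of [T] that contains [U] and the vector [x] outside it,
   so [x :: us] is independent and too long. *)
have := maxus (fun v => T v /\ S (g v)) (x :: us) satV _ _ _; rewrite /= ltnn.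
move=> contra; suff : false by []; apply: contra => //; first by move=> v [].
  apply: contrapT => nex; apply: nall => v Tv; apply: contrapT => nSv.
  by apply: nex; exists v => // -[].
split; last exact: independent_cons (sat_submodule_saturated satU) Uus nUx indep.
apply: all_of_cons => // k /Uus Uk; have Tk := UT _ Uk.
by split=> //; rewrite (ker _ Tk).2 //; case: satS => -[].
Qed.

(** Induction on a bound for the dimension. A proper saturated submodule of largest dimension has an
    irreducible quotient, and its own dimension is smaller. *)
Lemma series_exists (W : sl2mod) : rational_mod W -> exists l, series (fun _ : W => True) l.
Proof.
move=> rW; have [tf _ [vs span]] := (rational_modP W).1 rW.
suff H n (T : W -> Prop) : sat_submodule T ->
    (forall us, independent_in T us -> (size us <= n)%N) -> exists l, series T l.
  apply: (H (size vs)) => // us [_ indep]; rewrite leqNgt; apply/negP => lt.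
  by apply: indep; exact: (steinitz (vs := vs)).
elim: n T => [|n IH] T satT bound; have [T0|nT0] := pselect (forall v, T v -> v = 0).
1,3: by exists [::]; apply: series_nil => v; split=> [/T0|->] //; case: satT => -[].
  (* With bound [0], a nonzero [v] is already an independent family of size one. *)
  case: nT0 => v Tv; apply: contrapT => v0.
  have := bound [:: v]; rewrite ltnn => /(_ _)/notF; apply; split.
    by apply: all_of_cons.
  case=> q [[|//] _ q0]; rewrite lincomb_cons /lincomb big_ord0 addr0 => qv.
  by apply: v0; exact: tf q0 qv.
pose Q us := exists U : W -> Prop, [/\ sat_submodule U, forall v, U v -> T v,
  exists2 v, T v & ~ U v & independent_in U us].
have [||us [U [satU UT [t Tt nUt] iU]] maxus] :=
  @max_size_seq (zmodule_of W) Q n.+1.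
- exists (fun v => v = 0); split.
  + exact: sat_submodule0.
  + by move=> v ->; case: satT => -[].
  + apply: contrapT => nex; apply: nT0 => v Tv; apply: contrapT => v0.
    by apply: nex; exists v.
  + by split=> // -[q [k]].
- move=> us [U [_ UT _ [Uus iU]]]; apply: bound; split=> // k /Uus; exact: UT.
have bU us' : independent_in U us' -> (size us' <= n)%N.
  move=> [Uus' iU']; rewrite -ltnS; apply: (bound (t :: us')); split.
    by apply: all_of_cons => // k /Uus'; exact: UT.
  exact: independent_cons (sat_submodule_saturated satU) Uus' nUt iU'.
have [l ser] := IH U satU bU.
have [X [g [hg surj ker]]] := subquotient_exists (SubquotientData satT.1 satU.1 UT).
exists (rcons l X); apply: (series_rcons ser satT (g := g)); split=> //.
apply: (@maximal_factor_irreducible _ U T _ g us) => //; first by exists t.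
by move=> V us' satV VT nV iV; apply: maxus; exists V.
Qed.

(** * Translation between indexed and inductive series *)

Lemma comp_series_series (W : sl2mod) m Ws Xs gs : rational_mod W ->
  @comp_series W m Ws Xs gs ->
  series (fun _ : W => True) [seq Xs i | i <- iota 0 m].
Proof.
move=> rW [W0 [Wm [sub step]]].
suff H k : (k <= m)%N -> series (Ws k) [seq Xs i | i <- iota 0 k].
  by apply: series_ext (H m (leqnn m)).
elim: k => [|k IH] km; first exact: series_nil.
rewrite -addn1 iotaD map_cat cats1 addn1.
have [WW [hg [surj [ker irr]]]] := step k km.
apply: (series_rcons (IH (ltnW km)) (g := gs k)); last by split.
by apply/rational_submoduleP => //; exact: sub.
Qed.

Lemma series_comp_series (W : sl2mod) (T : W -> Prop) l : rational_mod W -> series T l ->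
  exists (Ws : nat -> W -> Prop) (F : nat -> {X : sl2mod & W -> X}),
  [/\ forall v, Ws 0%N v <-> v = 0, Ws (size l) = T,
      forall i, (i <= size l)%N -> rational_submodule (Ws i),
      forall i, (i < size l)%N -> factor (Ws i) (Ws i.+1) (projT2 (F i))
    & l = [seq projT1 (F i) | i <- iota 0 (size l)]].
Proof.
move=> rW; elim=> {T l} [S S0|S T X g l ser [Ws [F [W0 WS sub fct lE]]] satT fctT].
  exists (fun _ => S), (fun _ => existT _ W id); split=> // i _.
  by apply/rational_submoduleP => //; exact: sat_submodule0.
(* The old chain occupies the indices up to [size l], the new top comes next; its factor has index
   [size l]. *)
pose Ws' i := if (i <= size l)%N then Ws i else T.
pose F' i := if (i < size l)%N then F i else existT (fun X : sl2mod => W -> X) X g.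
exists Ws', F'; rewrite size_rcons; split.
- by [].
- by rewrite /Ws' ltnn.
- move=> i _; rewrite /Ws'; case: ifP => [/sub//|_].
  exact/rational_submoduleP.
- move=> i; rewrite ltnS leq_eqVlt /Ws' /F' => /orP[/eqP->|lt].
    by rewrite leqnn ltnn WS.
  by rewrite (ltnW lt) lt; exact: fct.
rewrite -[(size l).+1]addn1 iotaD map_cat -cats1 /= /F' ltnn; congr (_ ++ _).
rewrite [LHS]lE; apply/eq_in_map => i; rewrite mem_iota add0n => /= ->.
by [].
Qed.

Lemma JHsumP (W : sl2mod) u : rational_mod W ->
  JHsum W u <-> exists2 l, series (fun _ : W => True) l & u = unit_fsum l.
Proof.
move=> rW; split=> [[m [Ws [Xs [gs [cs ->]]]]]|[l ser ->]].
  by exists [seq Xs i | i <- iota 0 m]; [exact: comp_series_series cs|rewrite /unit_fsum -map_comp].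
have [Ws [F [W0 WS sub fct lE]]] := series_comp_series rW ser.
exists (size l), Ws, (fun i => projT1 (F i)), (fun i => projT2 (F i)); split.
  split=> //; split; first by move=> v; rewrite WS.
  by split=> // i /fct[a b c d e].
by rewrite {1}lE /unit_fsum -map_comp.
Qed.

(** The factors are kept: each projection is composed with the inverse of [i] on its image, given by
    its graph. *)
Lemma series_push (A B : sl2mod) (i : A -> B) (T : A -> Prop) l : rational_mod A ->
  rational_mod B -> Defs.hom i -> injective i -> series T l ->
  series (fun y => exists2 x, T x & i x = y) l.
Proof.
move=> rA rB hi inj; have i0 := hom0 (submodule_setT A) hi.
elim=> {T l} [S S0|S T X g l ser IH satT [ST hg surj ker irr]].
  apply: series_nil => y; split=> [[x /S0-> <-]//|->].
  by exists 0 => //; exact/S0.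
have satiT : sat_submodule (fun y => exists2 x, T x & i x = y).
  by apply: (sat_im (submodule_setT A) hi).
have [||||g' hg' gg'] := @hom_of_graph B X _
  (fun y z => exists2 x, T x & i x = y /\ g x = z) satiT.1.
- by move=> y [x Tx <-]; exists (g x), x.
- move=> z [x Tx []]; rewrite -i0 => /inj-> <-; exact: (hom0 satT.1 hg).
- move=> a y y' z z' [x Tx [<- <-]] [x' Tx' [<- <-]].
  exists (a *: x + x'); first exact: submodule_lin satT.1 Tx Tx'.
  by rewrite (hom_lin hi) // (hom_lin hg).
- move=> y z [x Tx [<- <-]]; have [_ [_ /(_ x Tx)[Te [Tf Th]]]] := satT.1.
  have [_ /(_ x I)[<- [<- <-]]] := hi; have [_ /(_ x Tx)[<- [<- <-]]] := hg.
  by split; [exists (act_e x)|exists (act_f x)|exists (act_h x)].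
have g'i x : T x -> g' (i x) = g x.
  move=> Tx; have [|x' _ [/inj-> -> //]] := gg' (i x); by exists x.
apply: (series_rcons IH satiT (g := g')); split=> //.
- by move=> y [x /ST Tx <-]; exists x.
- by move=> z; have [x Tx <-] := surj z; exists (i x); [exists x|exact: g'i].
move=> y [x Tx <-]; rewrite g'i // ker //; split=> [Sx|[x' Sx' /inj<-//]].
by exists x.
Qed.

(** Preimages of the terms are stacked on a series of the kernel, with projections composed with
    [p]. *)
Lemma series_pull (B D : sl2mod) (p : B -> D) (T : D -> Prop) l0 l : rational_mod B ->
  Defs.hom p -> (forall z, exists y, p y = z) ->
  series (fun y => p y = 0) l0 -> series T l -> series (fun y => T (p y)) (l0 ++ l).
Proof.
move=> rB hp psurj ser0; elim=> {T l} [S S0|S T X g l ser IH satT [ST hg surj ker irr]].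
  by rewrite cats0; apply: series_ext ser0 => v; split=> /S0.
rewrite -rcons_cat; apply: (series_rcons IH (g := g \o p)).
  have h := sat_preim (submodule_setT B) hp _ satT.
  have [|[S0 [Sl Sa]] cS] := h; first by [].
  split; last by move=> q v q0 Tv; case: (cS q v q0).
  split; first by case: S0.
  split=> [a x y Sx Sy|x Sx]; first by case: (Sl a x y).
  by have [[_ ?] [[_ ?] [_ ?]]] := Sa x (conj I Sx).
split=> //.
- by move=> v /ST.
- split=> [a x y Tx Ty|x Tx] /=; first by rewrite (hom_lin hp) // (hom_lin hg).
  by have [_ /(_ x I)[-> [-> ->]]] := hp; have [_] := hg; apply.
- by move=> z; have [v Tv <-] := surj z; have [y yv] := psurj v;
    exists y; rewrite /= yv.
by move=> v Tv; exact: ker.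
Qed.

(** * Grothendieck groups *)

Lemma all_in_cat P s t : all_in P (s ++ t) <-> all_in P s /\ all_in P t.
Proof. by elim: s => [|p s IH] /=; tauto. Qed.

Lemma all_in_sub (P Q : sl2mod -> Prop) s :
  (forall W, P W -> Q W) -> all_in P s -> all_in Q s.
Proof. by move=> PQ; elim: s => //= p s IH [/PQ Qp /IH]. Qed.

Lemma all_in_fscale P c s : all_in P (fscale c s) <-> all_in P s.
Proof. by elim: s => //= p s; tauto. Qed.

Lemma coef_fscale c s X : coef (fscale c s) X = c * coef s X.
Proof.
elim: s => [|p s IH] /=; first by rewrite mulr0.
by rewrite mulrDr IH; case: ifP; rewrite ?mulr0.
Qed.

Lemma coefE s X : coef s X = \sum_(p <- s | `[< iso p.2 X >]) p.1.
Proof.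
elim: s => [|p s IH] /=; first by rewrite big_nil.
by rewrite big_cons IH; case: ifP; rewrite ?add0r.
Qed.

(** The additive extension of [phi] to formal sums, through which invariants of K_0 are obtained. *)
Definition pairing (phi : sl2mod -> int) (s : fsum) : int := \sum_(p <- s) p.1 * phi p.2.

Definition iso_invariant (phi : sl2mod -> int) : Prop :=
  forall W W', iso W W' -> phi W = phi W'.

Lemma pairing_cat phi s t : pairing phi (s ++ t) = pairing phi s + pairing phi t.
Proof. exact: big_cat. Qed.

Lemma pairing_fscale phi c s : pairing phi (fscale c s) = c * pairing phi s.
Proof.
rewrite /pairing big_map mulr_sumr; apply: eq_bigr => p _; by rewrite mulrA.
Qed.

(** Induction on the length: all terms isomorphic to the first contribute its total coefficient
    times [phi], which is zero. Removing them leaves a shorter sum whose coefficients all vanish. *)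
Lemma pairing_eq0 phi s : iso_invariant phi -> (forall X, coef s X = 0) ->
  pairing phi s = 0.
Proof.
move=> inv; move: {2}(size s).+1 (ltnSn (size s)) => n.
elim: n s => // n IH [|p s] lt s0; first by rewrite /pairing big_nil.
pose b (q : int * sl2mod) := `[< iso q.2 p.2 >].
rewrite /pairing (bigID b) /=.
have -> : \sum_(q <- p :: s | b q) q.1 * phi q.2 = coef (p :: s) p.2 * phi p.2.
  rewrite coefE mulr_suml; apply: eq_bigr => q /asboolP h; by rewrite (inv _ _ h).
rewrite s0 mul0r add0r -big_filter; apply: IH.
  have bp : b p by apply/asboolP; exact: iso_refl.
  rewrite /= bp /= size_filter (leq_ltn_trans (count_size _ _)) //.
move=> X; rewrite coefE big_filter_cond.
have [pX|npX] := pselect (iso p.2 X).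
  apply: big_pred0 => q; apply/negP => /andP[/negP nb /asboolP qX].
  by apply: nb; apply/asboolP; exact: iso_trans qX (iso_sym pX).
rewrite -[RHS](s0 X) coefE; apply: eq_bigl => q.
case: asboolP => qX; rewrite ?andbF // andbT; apply/negP => /asboolP qp.
by apply: npX; exact: iso_trans (iso_sym qp) qX.
Qed.

Lemma pairing_free_eq phi s t : iso_invariant phi -> free_eq s t ->
  pairing phi s = pairing phi t.
Proof.
move=> inv st; apply/eqP; rewrite -subr_eq0 -mulN1r -pairing_fscale -pairing_cat.
apply/eqP/pairing_eq0 => // X.
by rewrite coef_cat coef_fscale st mulN1r subrr.
Qed.

Definition ses_sum (rs : seq (int * (sl2mod * sl2mod * sl2mod))) : fsum :=
  flatten [seq ses_rel r.1 r.2 | r <- rs].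

Definition ses_scale (c : int) (rs : seq (int * (sl2mod * sl2mod * sl2mod))) :=
  [seq (c * r.1, r.2) | r <- rs].

Lemma ses_sum_cat rs rs' : ses_sum (rs ++ rs') = ses_sum rs ++ ses_sum rs'.
Proof. by rewrite /ses_sum map_cat flatten_cat. Qed.

Lemma coef_ses_scale c rs X : coef (ses_sum (ses_scale c rs)) X = c * coef (ses_sum rs) X.
Proof.
rewrite -coef_fscale; congr (coef _ X).
elim: rs => // r rs IH; rewrite [LHS]/(ses_rel (c * r.1) r.2 ++ ses_sum (ses_scale c rs)) IH.
by rewrite /fscale map_cat /ses_rel /= !mulrN.
Qed.

Lemma ses_all_cat P rs rs' : ses_all P rs -> ses_all P rs' -> ses_all P (rs ++ rs').
Proof. by elim: rs => //= r rs IH [? /IH h] /h. Qed.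

Lemma ses_all_scale P c rs : ses_all P rs -> ses_all P (ses_scale c rs).
Proof. by elim: rs => //= r rs IH [? /IH]. Qed.

Lemma ses_all_sub (P Q : sl2mod -> Prop) rs :
  (forall W, P W -> Q W) -> ses_all P rs -> ses_all Q rs.
Proof. by move=> PQ; elim: rs => //= r rs IH [[/PQ ? [/PQ ? [/PQ ? ?]]] /IH]. Qed.

Lemma K0_free P s t : all_in P s -> all_in P t -> free_eq s t -> K0_eq P s t.
Proof. by move=> Ps Pt st; split=> //; split=> //; exists [::]; rewrite cats0. Qed.

Lemma K0_trans P s t u : K0_eq P s t -> K0_eq P t u -> K0_eq P s u.
Proof.
move=> [Ps [Pt [r1 [P1 e1]]]] [_ [Pu [r2 [P2 e2]]]]; split=> //; split=> //.
exists (r2 ++ r1); split; first exact: ses_all_cat.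
by move=> X; rewrite -/(ses_sum _) ses_sum_cat catA e1 coef_cat e2 [RHS]coef_cat.
Qed.

Lemma K0_sym P s t : K0_eq P s t -> K0_eq P t s.
Proof.
move=> [Ps [Pt [r [Pr e]]]]; split=> //; split=> //.
exists (ses_scale (-1) r); split; first exact: ses_all_scale.
move=> X; rewrite -/(ses_sum _) coef_cat coef_ses_scale mulN1r e coef_cat.
by rewrite -/(ses_sum _) addrK.
Qed.

Lemma K0_cat P s s' t t' : K0_eq P s t -> K0_eq P s' t' -> K0_eq P (s ++ s') (t ++ t').
Proof.
move=> [Ps [Pt [r1 [P1 e1]]]] [Ps' [Pt' [r2 [P2 e2]]]].
split; first exact/all_in_cat; split; first exact/all_in_cat.
exists (r1 ++ r2); split; first exact: ses_all_cat.
move=> X; rewrite -/(ses_sum _) ses_sum_cat !coef_cat e1 e2 !coef_cat.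
by rewrite addrACA.
Qed.

Lemma K0_scale P c s t : K0_eq P s t -> K0_eq P (fscale c s) (fscale c t).
Proof.
move=> [Ps [Pt [r [Pr e]]]]; split; first exact/all_in_fscale.
split; first exact/all_in_fscale.
exists (ses_scale c r); split; first exact: ses_all_scale.
move=> X; rewrite -/(ses_sum _) coef_cat coef_ses_scale !coef_fscale e coef_cat.
by rewrite mulrDr.
Qed.

(** An additive [phi] pairs to zero with each relation of a short exact sequence. *)
Lemma pairing_K0 P phi s t : iso_invariant phi ->
  (forall A B D, P A -> P B -> P D -> ses A B D -> phi B = phi A + phi D) ->
  K0_eq P s t -> pairing phi s = pairing phi t.
Proof.
move=> inv add [_ [_ [rs [Prs st]]]]; rewrite (pairing_free_eq inv st) pairing_cat.
suff -> : pairing phi (ses_sum rs) = 0 by rewrite addr0.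
elim: rs Prs {st} => [|[c [[A B] D]] rs IH]; first by rewrite /pairing big_nil.
move=> [[PA [PB [PD sABD]]] /IH e].
apply: etrans (pairing_cat phi (ses_rel c (A, B, D)) (ses_sum rs)) _; rewrite e addr0.
rewrite /pairing !big_cons big_nil /= addr0 (add _ _ _ PA PB PD sABD).
by rewrite !mulNr -opprD -mulrDr subrr.
Qed.

Lemma ses_K0 (P : sl2mod -> Prop) (A B D : sl2mod) : P A -> P B -> P D -> ses A B D ->
  K0_eq P [:: (1, B)] [:: (1, A); (1, D)].
Proof.
move=> PA PB PD h; split=> //; split=> //; exists [:: (1, (A, B, D))]; split=> //.
move=> X /=; rewrite !addr0.
case: ifP => _; case: ifP => _; case: ifP => _ //.
Qed.

(** For zero [A] the sequence [A -> A -> A] of identities is exact and gives [[A] = [A] + [A]]. *)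
Lemma zero_K0 (P : sl2mod -> Prop) (A : sl2mod) : P A -> (forall v : A, v = 0) ->
  K0_eq P [:: (1, A)] [::].
Proof.
move=> PA A0; split=> //; split=> //; exists [:: (-1, (A, A, A))]; split=> /=.
  split=> //; split=> //; split=> //; split=> //; exists id, id; split=> //.
  split=> //; split=> //; split; first by move=> z; exists z.
  by move=> y; split=> // _; exists y.
move=> X /=; rewrite !addr0; case: ifP => _ //.
Qed.

Lemma iso_rational (W W' : sl2mod) : iso W W' -> rational_mod W -> rational_mod W'.
Proof.
move=> [g [hg [g' gK g'K]]] rW; have sT := submodule_setT W.
apply: (quotient_rational sT hg rW _ (sat_submodule0 rW (fun v => iff_refl (v = 0)))).
- by split.
- by move=> z; exists (g' z).
- move=> v _; split=> [gv|->]; last exact: (hom0 sT hg).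
  by apply: (can_inj gK); rewrite gv (hom0 sT hg).
Qed.

(** Defined for every module so that it can be paired with formal sums: a series is chosen for
    rational [W], and the value is [0] otherwise. *)
Definition jh_mult (X W : sl2mod) : int :=
  match pselect (exists l, rational_mod W /\ series (fun _ : W => True) l) with
  | left e => coef (unit_fsum (projT1 (cid e))) X
  | right _ => 0
  end.

Lemma jh_multE (X W : sl2mod) l : rational_mod W -> series (fun _ : W => True) l ->
  jh_mult X W = coef (unit_fsum l) X.
Proof.
move=> rW ser; rewrite /jh_mult; case: pselect => [e|[]]; last by exists l.
by case: cid => l' [_ ser'] /=; exact: series_unique ser' ser X.
Qed.

Lemma jh_mult_iso (X : sl2mod) : iso_invariant (jh_mult X).
Proof.
have key W W' : iso W W' -> rational_mod W -> jh_mult X W = jh_mult X W'.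
  move=> WW' rW; have rW' := iso_rational WW' rW; have [l ser] := series_exists rW.
  rewrite (jh_multE X rW ser); case: WW' => g [hg [g' gK g'K]].
  rewrite (@jh_multE X W' l) //; apply: series_ext (series_push rW rW' hg (can_inj gK) ser).
  by move=> y; split=> // _; exists (g' y).
move=> W W' WW'; have [rW|nW] := pselect (rational_mod W); first exact: key.
have [rW'|nW'] := pselect (rational_mod W'); first by apply/esym/key => //; exact: iso_sym.
by rewrite /jh_mult; case: pselect => [[l []]//|_]; case: pselect => [[l []]//|_].
Qed.

Lemma jh_mult_ses (X A B D : sl2mod) : rational_mod A -> rational_mod B ->
  rational_mod D -> ses A B D -> jh_mult X B = jh_mult X A + jh_mult X D.
Proof.
move=> rA rB rD [i [p [hi [hp [inj [surj ker]]]]]].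
have [lA serA] := series_exists rA; have [lD serD] := series_exists rD.
rewrite (jh_multE X rA serA) (jh_multE X rD serD) -coef_cat /unit_fsum -map_cat.
apply: jh_multE => //; apply: (series_pull rB hp surj) serD.
apply: series_ext (series_push rA rB hi inj serA) => y.
by split=> [[x _ <-]|/ker[x ->]]; [apply/ker; exists x|exists x].
Qed.

(** Classes in K_0 belong to modules, not to subsets, so a term [T] is represented by any module [A]
    embedded with image [T]. Each step of the series then yields a short exact sequence. *)
Lemma series_K0 (W : sl2mod) (T : W -> Prop) l : rational_mod W -> series T l ->
  forall (A : sl2mod) (i : A -> W), rational_mod A -> Defs.hom i -> injective i ->
  (forall v, T v <-> exists x, i x = v) ->
  K0_eq rational_mod [:: (1, A)] (unit_fsum l).
Proof.
move=> rW; elim=> {T l} [S S0|S T X g l ser IH satT [ST hg surj ker irr]] A i rA hi inj im.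
  apply: zero_K0 => // v; apply: inj; rewrite (hom0 (submodule_setT A) hi).
  by apply/S0/im; exists v.
have satS := series_sat rW ser; have sT0 := sat_submodule0 rW (fun v => iff_refl (v = 0)).
have z0 v : v = 0 -> S v by move->; case: satS => -[].
(* [A'] is the term [S] made into a module, as the subquotient [S / 0]; below, [i'] inverts [q] and
   [j] is the inclusion of [A'] into [A]. *)
have [A' [q [hq qsurj qker]]] := subquotient_exists (SubquotientData satS.1 sT0.1 z0).
rewrite /= in hq qsurj qker.
have rA' : rational_mod A' := quotient_rational satS.1 hq rW satS sT0 qsurj qker.
have qinj x y : S x -> S y -> q x = q y -> x = y.
  move=> Sx Sy qxy; apply/eqP; rewrite -subr_eq0; apply/eqP/qker.
    exact: submodule_sub satS.1 Sx Sy.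
  by rewrite (homB hq) // qxy subrr.
have closed (x y : W) a : S x -> S y -> S (a *: x + y) := fun Sx Sy => submodule_lin a satS.1 Sx Sy.
have [||||i' hi' ii'] := @hom_of_graph A' W _ (fun a v => S v /\ q v = a) (submodule_setT A').
- by move=> a _; have [v Sv qv] := qsurj a; exists v.
- by move=> v [Sv /(qker _ Sv)].
- move=> a x x' y y' [Sy <-] [Sy' <-]; split; first exact: closed.
  by rewrite (hom_lin hq).
- move=> _ y [Sy <-]; have [_ [_ /(_ y Sy)[Se [Sf Sh]]]] := satS.1.
  by have [_ /(_ y Sy)[<- [<- <-]]] := hq.
have Si' a : S (i' a) by case: (ii' a I).
have qi' a : q (i' a) = a by case: (ii' a I).
have [||||j hj jj] := @hom_of_graph A' A _ (fun a x => i' a = i x) (submodule_setT A').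
- by move=> a _; have /im[x xE] := ST _ (Si' a); exists x.
- move=> x; rewrite (hom0 (submodule_setT A') hi') -(hom0 (submodule_setT A) hi).
  by move/inj.
- by move=> a x x' y y' e e'; rewrite (hom_lin hi') // (hom_lin hi) // e e'.
- move=> x y e; have [_ /(_ x I)[-> [-> ->]]] := hi'.
  by have [_ /(_ y I)[-> [-> ->]]] := hi; rewrite e.
have [rX _] := irr.
have Ti x : T (i x) by apply/im; exists x.
have sesA : ses A' A X.
  exists j, (g \o i); split=> //; split.
    split=> [a x y _ _|x _] /=; first by rewrite (hom_lin hi) // (hom_lin hg).
    by have [_ /(_ x I)[-> [-> ->]]] := hi; have [_] := hg; apply.
  split; first by move=> a b /(congr1 i); rewrite -!jj // => /(congr1 q); rewrite !qi'.
  split; first by move=> z; have [v /im[x <-] gv] := surj z; exists x.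
  move=> y /=; rewrite ker //; split=> [Siy|[x ->]]; last by rewrite -jj.
  by exists (q (i y)); apply: inj; rewrite -jj //; apply: qinj => //; rewrite qi'.
apply: K0_trans (ses_K0 rA' rA rX sesA) _.
rewrite /unit_fsum map_rcons -cats1 -cat1s; apply: K0_cat; last by apply: K0_free => /=.
apply: IH rA' hi' _ _; first by move=> a b /(congr1 q); rewrite !qi'.
by move=> v; split=> [Sv|[a <-//]]; exists (q v); apply: qinj; rewrite ?qi'.
Qed.

Lemma JHsum_K0 (W : sl2mod) u : rational_mod W -> JHsum W u ->
  K0_eq rational_mod [:: (1, W)] u.
Proof.
move=> rW /(JHsumP _ rW)[l ser ->].
have hid : Defs.hom (id : W -> W) by split=> // x _; do !split.
by apply: (series_K0 rW ser rW hid (fun x y e => e)) => v; split=> // _; exists v.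
Qed.

Lemma series_Spl (W : sl2mod) (T : W -> Prop) l : series T l -> all_in Spl (unit_fsum l).
Proof.
elim=> {T l} // S T X g l _ IH _ [_ _ _ _ irr].
rewrite /unit_fsum map_rcons -cats1; apply/all_in_cat; split=> //=; split=> //.
by split=> //; exact: irreducible_casimir.
Qed.

Lemma Spl_rational (W : sl2mod) : Spl W -> rational_mod W.
Proof. by case=> -[]. Qed.

Lemma JHsum_Spl (W : sl2mod) u : rational_mod W -> JHsum W u -> all_in Spl u.
Proof. by move=> rW /(JHsumP _ rW)[l ser ->]; exact: series_Spl ser. Qed.

Lemma JHsum_exists (W : sl2mod) : rational_mod W -> exists u, JHsum W u.
Proof.
move=> rW; have [l ser] := series_exists rW.
by exists (unit_fsum l); apply/(JHsumP _ rW); exists l.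
Qed.

Lemma JHsum_irreducible (X : sl2mod) : R_irreducible X -> JHsum X [:: (1, X)].
Proof.
move=> irr; have [rX _] := irr; apply/(JHsumP _ rX); exists [:: X] => //.
have ser0 : series (fun v : X => v = 0) [::] by exact: series_nil.
apply: (series_rcons ser0 (g := id : X -> X)); first by split.
by split=> // z; exists z.
Qed.

(** * The Jordan-Hoelder map on formal sums *)

Lemma chi_exists s : all_in rational_mod s -> exists u, chi_rel s u.
Proof.
elim: s => [_|[c W] s IH [/JHsum_exists[u Wu] /IH[v sv]]]; first by exists [::]; exact: chi_nil.
by exists (fscale c u ++ v); exact: chi_cons.
Qed.

Lemma chi_Spl s u : all_in rational_mod s -> chi_rel s u -> all_in Spl u.
Proof.
move=> rs su; elim: su rs => {s u} // c W u s v Wu _ IH [rW rs].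
by apply/all_in_cat; split; [apply/all_in_fscale; exact: JHsum_Spl Wu|exact: IH].
Qed.

Lemma chi_K0 s u : all_in rational_mod s -> chi_rel s u -> K0_eq rational_mod s u.
Proof.
move=> rs su; elim: su rs => {s u} [_|c W u s v Wu _ IH [rW rs]]; first exact: K0_free.
rewrite -cat1s; apply: K0_cat (IH rs).
apply: K0_trans (K0_scale c (JHsum_K0 rW Wu)).
by apply: K0_free => // X; rewrite /= mulr1.
Qed.

(** The right-hand side mentions no chosen series, so the coefficients depend only on [s]. *)
Lemma chi_pairing s u X : all_in rational_mod s -> chi_rel s u ->
  coef u X = pairing (jh_mult X) s.
Proof.
move=> rs su; elim: su rs => {s u} [_|c W u s v Wu _ IH [rW rs]].
  by rewrite /pairing big_nil.
have [l ser uE] := (JHsumP u rW).1 Wu.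
by rewrite coef_cat coef_fscale (IH rs) /pairing big_cons /= (jh_multE X rW ser) uE.
Qed.

(** Multiplicities are additive, so they are invariants of K_0. Conversely [s] equals [u] and [t]
    equals [v] in K_0. *)
Lemma chi_K0_eq s t u v : all_in rational_mod s -> all_in rational_mod t ->
  chi_rel s u -> chi_rel t v -> (K0_eq rational_mod s t <-> free_eq u v).
Proof.
move=> rs rt su tv; split=> [st X|uv].
  rewrite (chi_pairing X rs su) (chi_pairing X rt tv).
  apply: pairing_K0 st; first exact: jh_mult_iso.
  by move=> A B D; exact: jh_mult_ses.
apply: K0_trans (chi_K0 rs su) _; apply: K0_trans (K0_sym (chi_K0 rt tv)).
apply: K0_free => //; apply: all_in_sub Spl_rational _.
  exact: chi_Spl su.
exact: chi_Spl tv.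
Qed.

(** An irreducible module is its own only factor in the one-step series, so the map fixes such
    sums. *)
Lemma chi_of_Spl u : all_in Spl u -> exists2 u', chi_rel u u' & free_eq u' u.
Proof.
elim: u => [_|[c X] u IH [[irr _] /IH[u' uu' e]]]; first by exists [::]; first exact: chi_nil.
exists (fscale c [:: (1, X)] ++ u'); first exact/chi_cons/uu'/JHsum_irreducible.
by move=> Y; rewrite /= mulr1 e.
Qed.

Theorem theorem8p7 :
  (* devissage: the inclusion Spl -> R induces an isomorphism on K_0 *)
  ((forall s t : fsum, all_in Spl s -> all_in Spl t ->
      (K0_eq Spl s t <-> K0_eq rational_mod s t)) /\
   (forall s : fsum, all_in rational_mod s ->
      exists2 t : fsum, all_in Spl t & K0_eq rational_mod s t)) /\
  (* chi_JH : K_0(R) -> Z[Spl^] is a well-defined isomorphism *)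
  ((forall W : sl2mod, rational_mod W -> exists u : fsum, JHsum W u) /\
   (forall (W : sl2mod) (u : fsum), rational_mod W -> JHsum W u -> all_in Spl u) /\
   (forall s t u v : fsum, all_in rational_mod s -> all_in rational_mod t ->
      chi_rel s u -> chi_rel t v -> (K0_eq rational_mod s t <-> free_eq u v)) /\
   (forall u : fsum, all_in Spl u ->
      exists s : fsum, all_in rational_mod s /\
        exists2 u' : fsum, chi_rel s u' & free_eq u' u)).
Proof.
split.
  split=> [s t Ss St|s rs].
    split=> [[_ [_ [rs [Prs e]]]]|st].
      split; first exact: all_in_sub Spl_rational Ss.
      split; first exact: all_in_sub Spl_rational St.
      by exists rs; split=> //; exact: ses_all_sub Spl_rational Prs.
    (* Equality in K_0 of rational modules forces equal images, hence equality of [s] and [t]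
       already in the free group. *)
    have [s' ss' es] := chi_of_Spl Ss; have [t' tt' et] := chi_of_Spl St.
    have [rs [rt _]] := st.
    have e := (chi_K0_eq rs rt ss' tt').1 st.
    by apply: K0_free => // X; rewrite -es -et.
  have [t st] := chi_exists rs; exists t; first exact: chi_Spl st.
  exact: chi_K0.
split; first exact: JHsum_exists.
split; first exact: JHsum_Spl.
split; first exact: chi_K0_eq.
move=> u Su; exists u; split; first exact: all_in_sub Spl_rational Su.
exact: chi_of_Spl.
Qed.
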